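(* Let $\Omega$ be an eventually outward finitely branched tree quiver and $V$ a representation of $\Omega$ over a field. For each $\alpha\in\mathcal{C}$, if every arrow $e$ in $\alpha$ has exactly one virtual boundary arrow of $\Omega$ behind it, then the quotient map $F^\alpha\to W^\alpha=F^\alpha/\sum_{\beta<\alpha}F^\beta$ lifts, i.e. it admits a right inverse which is a morphism of representations; equivalently, there is a subrepresentation $C^\alpha\subseteq F^\alpha$ with $F^\alpha=C^\alpha\oplus\sum_{\beta<\alpha}F^\beta$. (Thus, if this hypothesis holds for every $\alpha\in\mathcal{C}$, there exists an almost gradation of the poset filtration $F$.)
   Context: A quiver $\Omega$ consists of a set $\Omega_0$ of vertices, a set $\Omega_1$ of arrows, and source and target functions $s,t:\Omega_1\to\Omega_0$. It is a tree if its underlying undirected graph is a tree (at most one arrow between two vertices, no loops). A walk is a map $w$ from a finite or infinite interval of $\mathbb{Z}$ to $\Omega_0$ with consecutive values joined by an arrow $e$; $e$ is oriented consistently if $s(e)=w_i,\ t(e)=w_{i+1}$, inconsistently if $s(e)=w_{i+1},\ t(e)=w_i$. A journey is a walk whose interval has a minimal element. $\Omega$ is finitely branched if it is a union of finitely many injective walks, and eventually outward if every injective journey contains at most finitely many arrows oriented inconsistently. Removing an arrow $e$ splits $\Omega$ into two connected subquivers: the one containing $t(e)$ is in front of $e$, and the one containing $s(e)$ is behind $e$. Anything contained in the former (latter) is in front of (behind) $e$, and $e$ points towards (away from) it. $\mathcal{C}$ is the set of (nonempty) connected full subquivers of $\Omega$. A boundary arrow of $\alpha\in\mathcal{C}$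 is an arrow with exactly one endpoint in $\alpha$; $\mathrm{iba}(\alpha)$ (resp. $\mathrm{oba}(\alpha)$) is the set of those pointing towards (resp. away from) $\alpha$. $\beta$ is a reduction of $\alpha$ if there is an arrow $e$ in $\alpha$ such that $\beta$ is the portion of $\alpha$ behind $e$; $\beta$ is an enhancement of $\alpha$ if there is an arrow $e$ in $\beta$ such that $\alpha$ is the portion of $\beta$ in front of $e$. Write $\alpha>\beta$ if $\beta$ is obtained from $\alpha$ by a finite sequence of one or more such moves. A representation $V$ consists of vector spaces $V_i$ ($i\in\Omega_0$) and linear maps $f_e:V_{s(e)}\to V_{t(e)}$ ($e\in\Omega_1$); $\mathrm{Sub}(V)$ is the poset of subrepresentations. The transport of a subspace of $V_i$ to a vertex $j$ follows the unique injective walk from $i$ to $j$, taking the image under $f_e$ when $e$ is crossed from $s(e)$ to $t(e)$ and the preimage under $f_e$ when $e$ is crossed from $t(e)$ to $s(e)$. For an arrow $e$: $V^{e,+}_i=V_i$ if $i$ is behind $e$, and otherwise the transport of $V_{t(e)}$ from $t(e)$ to $i$; $V^{e,-}_i=0$ if $i$ is in front of $e$, and otherwise the transport of $\{0\}\subseteq V_{t(e)}$ to $i$. These are subrepresentations of $V$. A virtual arrow $E$ is an injective journey with all arrows oriented away from its start, which is either infinite or ends in a leaf of $\Omega$ (possibly a single leaf vertex). $V^{E,+}_i=V_i$ if $i\in E$, and otherwise the transport to $i$ of $V_j$, with $j$ the vertex of $E$ closest to $i$. Virtual arrows that differ only in where they start (one is an end segment of the other) define the same subrepresentation and are counted as the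 same. If $E$ lies entirely in $\alpha$ it is a virtual boundary arrow of $\alpha$ (in particular every virtual arrow is a virtual boundary arrow of $\Omega$); $E$ is behind $e$ if, after possibly passing to an end segment, it lies in the subquiver behind $e$. For $\alpha\in\mathcal{C}$, $F^\alpha$ is the intersection of all $V^{e,+}$ for $e\in\mathrm{iba}(\alpha)$, all $V^{e,-}$ for $e\in\mathrm{oba}(\alpha)$, and all $V^{E,+}$ for $E$ a virtual boundary arrow of $\alpha$. The map $F:\mathcal{C}\to\mathrm{Sub}(V)$ is a poset filtration: $F^\beta\subseteq F^\alpha$ for $\beta\le\alpha$. An almost gradation of $F$ is a function $C:\mathcal{C}\to\mathrm{Sub}(V)$ with $F^\alpha=C^\alpha\oplus\sum_{\beta<\alpha}F^\beta$ for all $\alpha\in\mathcal{C}$. *)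

(* Defs.v *)
From HB Require Import structures.
From mathcomp Require Import all_boot all_order all_algebra.
From Stdlib Require Import Relation_Operators.
From mathcomp Require Import boolp classical_sets functions cardinality.

Set Implicit Arguments.
Unset Strict Implicit.
Unset Printing Implicit Defensive.

Import Order.TTheory GRing.Theory Num.Theory.
Local Open Scope classical_set_scope.
Local Open Scope ring_scope.
Local Open Scope quotient_scope.

Record quiver := Quiver {
  vertex :> Type;
  arrow : Type;
  src : arrow -> vertex;
  tgt : arrow -> vertex }.

Section FiniteWalks.
Variable Q : quiver.
Implicit Types (i j : Q) (e : arrow Q).

(* Walks from i to j on a finite nonempty interval, recording which arrow is
   crossed at each step and in which direction. *)
Inductive fwalk (i : Q) : Q -> Type :=
| fw_nil : fwalk i i
| fw_fwd e : fwalk i (src e) -> fwalk i (tgt e)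
| fw_bwd e : fwalk i (tgt e) -> fwalk i (src e).

Fixpoint fw_length i j (p : fwalk i j) : nat :=
  match p with
  | fw_nil => 0
  | fw_fwd _ q => (fw_length q).+1
  | fw_bwd _ q => (fw_length q).+1
  end.

Fixpoint fw_vertices i j (p : fwalk i j) : set Q :=
  match p with
  | fw_nil => [set i]
  | fw_fwd e q => fw_vertices q `|` [set tgt e]
  | fw_bwd e q => fw_vertices q `|` [set src e]
  end.

Fixpoint fw_arrows i j (p : fwalk i j) : set (arrow Q) :=
  match p with
  | fw_nil => set0
  | fw_fwd e q => fw_arrows q `|` [set e]
  | fw_bwd e q => fw_arrows q `|` [set e]
  end.

Fixpoint fw_injective i j (p : fwalk i j) : Prop :=
  match p with
  | fw_nil => True
  | fw_fwd e q => fw_injective q /\ ~ fw_vertices q (tgt e)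
  | fw_bwd e q => fw_injective q /\ ~ fw_vertices q (src e)
  end.

Definition connected_full (A : set Q) : Prop :=
  A !=set0 /\
  forall i j, A i -> A j -> exists p : fwalk i j, fw_vertices p `<=` A.

(* A cycle is an arrow closed up by an injective walk that does not cross it;
   the cycles with one or two vertices are the loops and the pairs of arrows
   joining the same two vertices. *)
Definition acyclic : Prop :=
  forall e (p : fwalk (tgt e) (src e)), fw_injective p -> fw_arrows p e.

Definition is_tree : Prop := connected_full [set: Q] /\ acyclic.

Definition joins e i j : Prop :=
  (src e = i /\ tgt e = j) \/ (src e = j /\ tgt e = i).

Definition leaf i : Prop :=
  exists e, (src e = i \/ tgt e = i) /\
    forall e', src e' = i \/ tgt e' = i -> e' = e.

Definition in_front e : set Q :=
  [set i | exists p : fwalk (tgt e) i, ~ fw_arrows p e].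

Definition behind e : set Q :=
  [set i | exists p : fwalk (src e) i, ~ fw_arrows p e].

End FiniteWalks.

Arguments fw_nil {Q i}.

Record tree := Tree {
  tree_quiver :> quiver;
  treeP : is_tree tree_quiver }.

Section Walks.
Variable Q : quiver.

(* The values of walk_map outside of the interval walk_dom are irrelevant. *)
Record walk := Walk {
  walk_dom : interval int;
  walk_map :> int -> Q;
  walkP : forall i, i \in walk_dom -> i + 1 \in walk_dom ->
    exists e, joins e (walk_map i) (walk_map (i + 1)) }.

Definition walk_injective (w : walk) : Prop :=
  {in walk_dom w &, injective w}.

Definition journey (w : walk) : Prop :=
  exists2 m, m \in walk_dom w & forall i, i \in walk_dom w -> m <= i.

Definition consistent_at (w : walk) (i : int) (e : arrow Q) : Prop :=
  [/\ i \in walk_dom w, i + 1 \in walk_dom w, src e = w i & tgt e = w (i + 1)].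

Definition inconsistent_at (w : walk) (i : int) (e : arrow Q) : Prop :=
  [/\ i \in walk_dom w, i + 1 \in walk_dom w, src e = w (i + 1) & tgt e = w i].

Definition walk_vertices (w : walk) : set Q := w @` [set` walk_dom w].

Definition walk_arrows (w : walk) : set (arrow Q) :=
  [set e | exists i, consistent_at w i e \/ inconsistent_at w i e].

Definition finitely_branched : Prop :=
  exists (n : nat) (w : 'I_n -> walk),
    [/\ forall a, walk_injective (w a),
        \bigcup_a walk_vertices (w a) = [set: Q] &
        \bigcup_a walk_arrows (w a) = [set: arrow Q]].

Definition eventually_outward : Prop :=
  forall w, journey w -> walk_injective w ->
    finite_set [set e | exists i, inconsistent_at w i e].

Definition is_virtual_arrow (w : walk) : Prop :=
  [/\ journey w, walk_injective w,
      forall i, i \in walk_dom w -> i + 1 \in walk_dom w ->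
        exists e, consistent_at w i e &
      infinite_set [set` walk_dom w] \/
      exists m, [/\ m \in walk_dom w, forall i, i \in walk_dom w -> i <= m &
                    leaf (w m)]].

Record varrow := VArrow {
  varrow_walk :> walk;
  varrowP : is_virtual_arrow varrow_walk }.

(* E is an end segment of E', up to translation of the indexing interval. *)
Definition end_segment (E E' : varrow) : Prop :=
  exists d : int,
    (forall i, i \in walk_dom E ->
       i + d \in walk_dom E' /\ walk_map E i = walk_map E' (i + d)) /\
    (forall i j, i \in walk_dom E -> j \in walk_dom E' -> i + d <= j ->
       j - d \in walk_dom E).

Definition same_varrow : varrow -> varrow -> Prop :=
  clos_refl_sym_trans varrow end_segment.

Definition virtual_boundary (A : set Q) (E : varrow) : Prop :=
  walk_vertices E `<=` A.

Definition varrow_behind (E : varrow) (e : arrow Q) : Prop :=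
  exists2 E' : varrow, end_segment E' E & walk_vertices E' `<=` behind e.

Definition one_virtual_boundary_behind (e : arrow Q) : Prop :=
  exists E : varrow,
    [/\ virtual_boundary [set: Q] E, varrow_behind E e &
        forall E' : varrow, virtual_boundary [set: Q] E' ->
          varrow_behind E' e -> same_varrow E E'].

(* The vertex of A closest to i, for the distance given by the length of
   walks. *)
Definition closest (A : set Q) (i j : Q) : Prop :=
  A j /\ exists p : fwalk j i,
    forall j' (q : fwalk j' i), A j' -> (fw_length p <= fw_length q)%N.

End Walks.

Section ConnectedSubquivers.
Variable Q : quiver.

(* A connected full subquiver is given by its set of vertices. *)
Record csub := CSub {
  csub_set : set Q;
  csubP : connected_full csub_set }.
Implicit Types (a b : csub) (e : arrow Q).

Definition arrow_in a e : Prop := csub_set a (src e) /\ csub_set a (tgt e).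

Definition boundary_arrow a e : Prop :=
  (csub_set a (src e) /\ ~ csub_set a (tgt e)) \/ (~ csub_set a (src e) /\ csub_set a (tgt e)).

Definition iba a : set (arrow Q) :=
  [set e | boundary_arrow a e /\ csub_set a `<=` in_front e].

Definition oba a : set (arrow Q) :=
  [set e | boundary_arrow a e /\ csub_set a `<=` behind e].

Definition reduction a b : Prop :=
  exists2 e, arrow_in a e & csub_set b = csub_set a `&` behind e.

Definition enhancement a b : Prop :=
  exists2 e, arrow_in b e & csub_set a = csub_set b `&` in_front e.

Definition csub_lt b a : Prop :=
  clos_trans csub
    (fun x y => reduction x y \/ enhancement x y) a b.

End ConnectedSubquivers.

Record rep (k : fieldType) (Q : quiver) := Rep {
  rep_space :> Q -> lmodType k;
  rep_map : forall e : arrow Q,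
    {linear rep_space (src e) -> rep_space (tgt e)} }.

Arguments rep_map {k Q} r e.

Section Representations.
Variables (k : fieldType) (Q : quiver).
Implicit Types V W : rep k Q.

Record rep_hom V W := RepHom {
  hom_map :> forall i, {linear V i -> W i};
  hom_natural : forall e x,
    hom_map (tgt e) (rep_map V e x) = rep_map W e (hom_map (src e) x) }.

Definition has_right_inverse V W (g : rep_hom V W) : Prop :=
  exists s : rep_hom W V, forall i x, g i (s i x) = x.

Record subrep V := SubRep {
  subrep_set :> forall i, set (V i);
  subrep_closed : forall i, submod_closed [in @subrep_set i];
  subrep_stable : forall e x,
    @subrep_set (src e) x -> @subrep_set (tgt e) (rep_map V e x) }.
Arguments subrep_set {V} _ i _.

Definition subrep_le V (A B : subrep V) : Prop := forall i, A i `<=` B i.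

Definition internal_dsum V (U A B : subrep V) : Prop :=
  forall i, U i = [set x + y | x in A i & y in B i] /\
            A i `&` B i = [set 0].

End Representations.

Section Subspaces.
Variables (k : fieldType) (V : lmodType k) (A : set V).
Hypothesis Acl : submod_closed [in A].

Definition subspace of submod_closed [in A] : Type := set_type A.
Local Notation S := (subspace Acl).
HB.instance Definition _ := SubChoice.on S.
HB.instance Definition _ :=
  GRing.SubChoice_isSubLmodule.Build k V [in A] S Acl.

Definition subspace_pred of submod_closed [in A] : {pred V} :=
  fun x => x \in A.
HB.instance Definition _ :=
  GRing.isSubmodClosed.Build k V (subspace_pred Acl) Acl.

Definition quotient := Quotient.quot (subspace_pred Acl : zmodClosed V).
Local Notation T := quotient.
HB.instance Definition _ := GRing.Zmodule.on T.
HB.instance Definition _ := EqQuotient.on T.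

Definition proj (x : V) : T := \pi_T x.

Lemma proj_eq x y : proj x = proj y <-> A (x - y).
Proof.
rewrite /proj; split.
  by move/eqP; rewrite -Quotient.idealrBE => /set_mem.
by move=> h; apply/eqP; rewrite -Quotient.idealrBE; exact: mem_set.
Qed.

Lemma projK (x : T) : proj (repr x) = x.
Proof. exact: reprK. Qed.

Lemma projD : {morph proj : x y / x + y}.
Proof. by move=> x y; rewrite /proj raddfD. Qed.

Definition scaleq (a : k) (x : T) : T := proj (a *: repr x).

Lemma scaleq_proj a x : scaleq a (proj x) = proj (a *: x).
Proof.
apply/proj_eq; rewrite -scalerBr.
have /proj_eq : proj (repr (proj x)) = proj x by exact: projK.
move=> /mem_set h; apply: set_mem; rewrite -[_ *: _]addr0.
by apply: Acl.2 => //; exact: Acl.1.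
Qed.

Fact scaleqA a b x : scaleq a (scaleq b x) = scaleq (a * b) x.
Proof. by rewrite -[x]projK !scaleq_proj scalerA. Qed.
Fact scale1q : left_id 1 scaleq.
Proof. by move=> x; rewrite -[x]projK scaleq_proj scale1r. Qed.
Fact scaleqDr : right_distributive scaleq +%R.
Proof.
by move=> a x y; rewrite -[x]projK -[y]projK -projD !scaleq_proj -projD scalerDr.
Qed.
Fact scaleqDl x : {morph scaleq^~ x : a b / a + b}.
Proof.
by move=> a b; rewrite -[x]projK !scaleq_proj -projD scalerDl.
Qed.
HB.instance Definition _ :=
  GRing.Zmodule_isLmodule.Build k T scaleqA scale1q scaleqDr scaleqDl.

Fact proj_linear : linear proj.
Proof. by move=> a x y; rewrite projD -scaleq_proj. Qed.
HB.instance Definition _ := GRing.isLinear.Build k V T _ proj proj_linear.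

End Subspaces.

Section SubQuotients.
Variables (k : fieldType) (Q : quiver).
Implicit Types V : rep k Q.

Definition subrep_map V (U : subrep V) (e : arrow Q)
    (x : subspace (subrep_closed U (src e))) :
    subspace (subrep_closed U (tgt e)) :=
  SigSub (mem_set (subrep_stable (set_mem (valP x)))).

Fact subrep_map_linear V (U : subrep V) e : linear (@subrep_map V U e).
Proof. by move=> a x y; apply: val_inj; rewrite /= !linearP. Qed.
HB.instance Definition _ V (U : subrep V) e :=
  GRing.isLinear.Build k _ _ _ (@subrep_map V U e) (@subrep_map_linear V U e).

Definition subrep_rep V (U : subrep V) : rep k Q :=
  @Rep k Q (fun i => subspace (subrep_closed U i)) (@subrep_map V U).

Definition quot_map V (N : subrep V) (e : arrow Q)
    (x : quotient (subrep_closed N (src e))) :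
    quotient (subrep_closed N (tgt e)) :=
  proj (subrep_closed N (tgt e)) (rep_map V e (repr x)).

Lemma quot_map_proj V (N : subrep V) (e : arrow Q) x :
  quot_map (proj (subrep_closed N (src e)) x) =
  proj (subrep_closed N (tgt e)) (rep_map V e x).
Proof.
apply/proj_eq; rewrite -linearB; apply: subrep_stable.
by apply/(proj_eq (subrep_closed N (src e))); exact: projK.
Qed.

Fact quot_map_linear V (N : subrep V) e : linear (@quot_map V N e).
Proof.
move=> a x y; rewrite -[x]projK -[y]projK -linearP !quot_map_proj.
by rewrite -!linearP.
Qed.
HB.instance Definition _ V (N : subrep V) e :=
  GRing.isLinear.Build k _ _ _ (@quot_map V N e) (@quot_map_linear V N e).

Definition quot_rep V (N : subrep V) : rep k Q :=
  @Rep k Q (fun i => quotient (subrep_closed N i)) (@quot_map V N).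

Definition quot_hom V (N : subrep V) : rep_hom V (quot_rep N) :=
  @RepHom k Q V (quot_rep N)
    (fun i => proj (subrep_closed N i) : {linear V i -> quot_rep N i})
    (fun e x => esym (quot_map_proj N x)).

(* The intersection of A and B, as a subrepresentation of A. *)
Definition sub_in_set V (A B : subrep V) (i : Q) : set (subrep_rep A i) :=
  [set x : subspace (subrep_closed A i) | B i (\val x)].

Lemma sub_in_closed V (A B : subrep V) i :
  submod_closed [in @sub_in_set V A B i].
Proof.
have [B0 BZ] := subrep_closed B i; split=> [|a x y].
  by apply: mem_set; exact: set_mem B0.
move=> /set_mem /= Bx /set_mem /= By; apply: mem_set => /=.
change (B i (a *: \val x + \val y)); apply: set_mem.
by apply: BZ; exact: mem_set.
Qed.

Lemma sub_in_stable V (A B : subrep V) e x : @sub_in_set V A B (src e) x ->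
  @sub_in_set V A B (tgt e) (rep_map (subrep_rep A) e x).
Proof. by move=> Bx; exact: subrep_stable. Qed.

Definition sub_in V (A B : subrep V) : subrep (subrep_rep A) :=
  SubRep (sub_in_closed A B) (@sub_in_stable V A B).

End SubQuotients.

Section Transport.
Variables (k : fieldType) (Q : quiver) (V : rep k Q).

Fixpoint transport_along i (U : set (V i)) j (p : fwalk i j) : set (V j) :=
  match p in fwalk _ j return set (V j) with
  | fw_nil => U
  | fw_fwd e q => rep_map V e @` transport_along U q
  | fw_bwd e q => rep_map V e @^-1` transport_along U q
  end.

(* In a tree there is exactly one injective walk from i to j. *)
Definition transport i (U : set (V i)) j : set (V j) :=
  [set y | exists2 p : fwalk i j, fw_injective p & transport_along U p y].

Arguments transport {i} U j _.

Definition arrow_plus (e : arrow Q) (i : Q) : set (V i) :=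
  if `[< behind e i >] then setT else transport [set: V (tgt e)] i.

Definition arrow_minus (e : arrow Q) (i : Q) : set (V i) :=
  if `[< in_front e i >] then [set 0] else transport [set (0 : V (tgt e))] i.

Definition virtual_plus (E : varrow Q) (i : Q) : set (V i) :=
  if `[< walk_vertices E i >] then setT
  else [set y | exists2 j, closest (walk_vertices E) i j &
                           transport [set: V j] i y].

Arguments arrow_plus e i _ : clear implicits.
Arguments arrow_minus e i _ : clear implicits.
Arguments virtual_plus E i _ : clear implicits.

Definition filtration_set (a : csub Q) (i : Q) : set (V i) :=
  (\bigcap_(e in iba a) arrow_plus e i) `&`
  (\bigcap_(e in oba a) arrow_minus e i) `&`
  (\bigcap_(E in virtual_boundary (csub_set a)) virtual_plus E i).

End Transport.

Arguments transport {k Q} V {i} U j _.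
Arguments arrow_plus {k Q} V e i _.
Arguments arrow_minus {k Q} V e i _.
Arguments virtual_plus {k Q} V E i _.
Arguments filtration_set {k Q} V a i _.

Section WalkFacts.
Variable Q : quiver.
Implicit Types (i j : Q) (e : arrow Q).

Fixpoint fw_cat i j l (p : fwalk i j) (q : fwalk j l) : fwalk i l :=
  match q with
  | fw_nil => p
  | fw_fwd e q => fw_fwd (fw_cat p q)
  | fw_bwd e q => fw_bwd (fw_cat p q)
  end.

Fixpoint fw_rev i j (p : fwalk i j) : fwalk j i :=
  match p with
  | fw_nil => fw_nil
  | fw_fwd e q => fw_cat (fw_bwd fw_nil) (fw_rev q)
  | fw_bwd e q => fw_cat (fw_fwd fw_nil) (fw_rev q)
  end.

Lemma fw_start i j (p : fwalk i j) : fw_vertices p i.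
Proof. by elim: p => [|e q|e q] //= ?; left. Qed.

Lemma fw_end i j (p : fwalk i j) : fw_vertices p j.
Proof. by case: p => [|e q|e q] //=; right. Qed.

Lemma fw_vertices_cat i j l (p : fwalk i j) (q : fwalk j l) :
  fw_vertices (fw_cat p q) = fw_vertices p `|` fw_vertices q.
Proof.
elim: q => [|e q IH|e q IH] /=.
- by apply/esym/setUidl => _ ->; exact: fw_end.
- by rewrite IH setUA.
- by rewrite IH setUA.
Qed.

Lemma fw_arrows_cat i j l (p : fwalk i j) (q : fwalk j l) :
  fw_arrows (fw_cat p q) = fw_arrows p `|` fw_arrows q.
Proof. by elim: q => [|e q IH|e q IH] /=; rewrite ?setU0 // IH setUA. Qed.

Lemma fw_arrows_rev i j (p : fwalk i j) : fw_arrows (fw_rev p) = fw_arrows p.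
Proof.
elim: p => [|e q IH|e q IH] //=;
by rewrite fw_arrows_cat IH /= set0U setUC.
Qed.

Lemma fw_arrow_ends i j (p : fwalk i j) e :
  fw_arrows p e -> fw_vertices p (src e) /\ fw_vertices p (tgt e).
Proof.
elim: p => [|e' q IH|e' q IH] //= [/IH[]|->].
- by move=> ? ?; split; left.
- by split; [left; exact: fw_end|right].
- by move=> ? ?; split; left.
- by split; [right|left; exact: fw_end].
Qed.

Lemma fw_trunc i j (p : fwalk i j) v : fw_injective p -> fw_vertices p v ->
  exists q : fwalk i v, [/\ fw_injective q, fw_vertices q `<=` fw_vertices p,
    fw_arrows q `<=` fw_arrows p, (fw_length q <= fw_length p)%N &
    v <> j -> ~ fw_vertices q j].
Proof.
elim: p v => [v _ -> /=|e p IH v [pI ep]|e p IH v [pI ep]].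
- by exists fw_nil; split => // -[].
- move=> [/(IH v pI)[q [qI qv qa ql qn]]|->] /=.
    exists q; split => //.
    + by move=> x /qv; left.
    + by move=> x /qa; left.
    + exact: leqW.
    + by move=> _ /qv.
  by exists (fw_fwd p); split => // -[].
- move=> [/(IH v pI)[q [qI qv qa ql qn]]|->] /=.
    exists q; split => //.
    + by move=> x /qv; left.
    + by move=> x /qa; left.
    + exact: leqW.
    + by move=> _ /qv.
  by exists (fw_bwd p); split => // -[].
Qed.

Lemma fw_reduce i j (p : fwalk i j) :
  exists q : fwalk i j, [/\ fw_injective q, fw_vertices q `<=` fw_vertices p,
    fw_arrows q `<=` fw_arrows p & (fw_length q <= fw_length p)%N].
Proof.
elim: p => [|e p [q [qI qv qa ql]]|e p [q [qI qv qa ql]]].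
- by exists fw_nil; split => // -[].
- have [h|h] := pselect (fw_vertices q (tgt e)).
    have [r [rI rv ra rl _]] := fw_trunc qI h; exists r; split => //=.
    + by move=> x /rv/qv; left.
    + by move=> x /ra/qa; left.
    + by rewrite (leq_trans rl)// leqW.
  exists (fw_fwd q); split => //=.
  + by move=> x [/qv|]; [left|right].
  + by move=> x [/qa|]; [left|right].
- have [h|h] := pselect (fw_vertices q (src e)).
    have [r [rI rv ra rl _]] := fw_trunc qI h; exists r; split => //=.
    + by move=> x /rv/qv; left.
    + by move=> x /ra/qa; left.
    + by rewrite (leq_trans rl)// leqW.
  exists (fw_bwd q); split => //=.
  + by move=> x [/qv|]; [left|right].
  + by move=> x [/qa|]; [left|right].
Qed.

Lemma fw_suffix i j (p : fwalk i j) v : fw_vertices p v ->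
  exists q : fwalk v j, [/\ fw_vertices q `<=` fw_vertices p,
    (fw_length q <= fw_length p)%N &
    v <> i -> (fw_length q < fw_length p)%N].
Proof.
elim: p => [->|e p IH|e p IH] /=.
- by exists fw_nil; split => // -[].
- move=> [/IH[q [qv ql qn]]|->].
    exists (fw_fwd q); split => //=.
    by move=> x [/qv|]; [left|right].
  by exists fw_nil; split => //= x ->; right.
- move=> [/IH[q [qv ql qn]]|->].
    exists (fw_bwd q); split => //=.
    by move=> x [/qv|]; [left|right].
  by exists fw_nil; split => //= x ->; right.
Qed.

Lemma fw_cat_injective i j l (p : fwalk i j) (q : fwalk j l) :
  fw_injective p -> fw_injective q ->
  (forall v, fw_vertices p v -> fw_vertices q v -> v = j) ->
  fw_injective (fw_cat p q).
Proof.
move=> pI; elim: q => [//|e q IH|e q IH] /= [qI qe] pq.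
- split; first by apply: IH => // v pv qv; apply: pq => //; left.
  rewrite fw_vertices_cat => -[pe|//].
  by apply: qe; rewrite (pq _ pe); [exact: fw_start|right].
- split; first by apply: IH => // v pv qv; apply: pq => //; left.
  rewrite fw_vertices_cat => -[pe|//].
  by apply: qe; rewrite (pq _ pe); [exact: fw_start|right].
Qed.

Lemma itv_convex (I : interval int) (a b c : int) :
  a \in I -> c \in I -> a <= b <= c -> b \in I.
Proof.
case: I => l u aI cI /andP[ab bc]; move: aI cI; rewrite !itv_boundlr.
move=> /andP[la _] /andP[_ cu]; apply/andP; split.
  by apply: le_trans la _; rewrite bnd_simp.
by apply: le_trans cu; rewrite bnd_simp.
Qed.

Lemma walk_connected (w : walk Q) x y :
  walk_vertices w x -> walk_vertices w y ->
  exists p : fwalk x y, fw_vertices p `<=` walk_vertices w.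
Proof.
have H (i : int) (n : nat) : i \in walk_dom w -> i + n%:Z \in walk_dom w ->
    (exists p : fwalk (w i) (w (i + n%:Z)),
      fw_vertices p `<=` walk_vertices w) /\
    (exists p : fwalk (w (i + n%:Z)) (w i),
      fw_vertices p `<=` walk_vertices w).
  move=> iw; elim: n => [|n IH].
    by rewrite addr0 => _; split; exists fw_nil => _ ->; exists i.
  rewrite -addn1 PoszD addrA => jw.
  have {}nw : i + n%:Z \in walk_dom w.
    by apply: itv_convex iw jw _; rewrite lerDl /= lerDl.
  have {IH} [[p pw] [q qw]] := IH nw.
  have wj : walk_vertices w (w (i + n%:Z + 1)) by exists (i + n%:Z + 1).
  have wi : walk_vertices w (w (i + n%:Z)) by exists (i + n%:Z).
  have [e [[es et]|[et es]]] := walkP nw jw; rewrite -?es -?et in p q pw qw wj wi *.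
  - split; first by exists (fw_fwd p) => /= z [/pw//|->].
    exists (fw_cat (fw_bwd fw_nil) q) => z; rewrite fw_vertices_cat /=.
    by move=> [[->|->]|/qw].
  - split; first by exists (fw_bwd p) => /= z [/pw//|->].
    exists (fw_cat (fw_fwd fw_nil) q) => z; rewrite fw_vertices_cat /=.
    by move=> [[->|->]|/qw].
move=> [i /= iw <-] [j /= jw <-].
have [ij|/ltW ij] := leP i j.
  have E : j = i + `|j - i|%N%:Z by rewrite gez0_abs ?subr_ge0// addrCA subrr addr0.
  by rewrite E in jw *; have [] := H _ _ iw jw.
have E : i = j + `|i - j|%N%:Z by rewrite gez0_abs ?subr_ge0// addrCA subrr addr0.
by rewrite E in iw *; have [] := H _ _ jw iw.
Qed.

End WalkFacts.

Section TreeFacts.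
Variable Q : tree.
Implicit Types (i j : Q) (e : arrow Q).

Lemma no_detour e i j (p : fwalk i j) : joins e i j -> fw_arrows p e.
Proof.
have H (q : fwalk (tgt e) (src e)) : fw_arrows q e.
  have [r [rI _ ra _]] := fw_reduce q.
  exact/ra/(treeP Q).2.
move=> [[ei ej]|[ej ei]]; move: p; rewrite -ei -ej => p; last exact: H.
by rewrite -fw_arrows_rev; exact: H.
Qed.

Lemma no_loop e : src e <> tgt e.
Proof.
by move=> h; apply: (@no_detour e (tgt e) (tgt e) fw_nil); left.
Qed.

Lemma key_cycle e e' i a a' b (p : fwalk i a) (p' : fwalk i a') :
  joins e a b -> joins e' a' b -> ~ fw_vertices p b -> ~ fw_vertices p' b ->
  e = e'.
Proof.
move=> eab eab' pb pb'; apply: contrapT => ee'.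
have endb (j : Q) (q : fwalk i j) : ~ fw_vertices q b -> ~ fw_arrows q e.
  move=> qb /fw_arrow_ends[qs qt]; apply: qb.
  by case: eab => -[h1 h2]; rewrite -?h1 -?h2 in qs qt *.
have: exists r : fwalk a b, ~ fw_arrows r e.
  pose r := fw_cat (fw_rev p) p'.
  have ra : ~ fw_arrows r e.
    by rewrite fw_arrows_cat fw_arrows_rev => -[]; exact: endb.
  case: eab' => -[h1 h2]; move: (r) ra; rewrite -?h1 -?h2 => q qa.
    by exists (fw_fwd q) => -[].
  by exists (fw_bwd q) => -[].
by move=> [r]; apply; exact: no_detour.
Qed.

Lemma existT_inj (T : Type) (P : T -> Type) (x : T) (u v : P x) :
  existT P x u = existT P x v -> u = v.
Proof.
move=> h; have /= := projT2_eq h.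
by rewrite (Prop_irrelevance (projT1_eq h) erefl).
Qed.

Lemma fw_uniq_sig i j (p : fwalk i j) j' (q : fwalk i j') :
  fw_injective p -> fw_injective q -> j = j' ->
  existT (fwalk i) j p = existT (fwalk i) j' q.
Proof.
move=> pI; elim: p pI j' q => [_|e p IH [pI pe]|e p IH [pI pe]] j' [] //=.
- by move=> e q [_ qe] h; case: qe; rewrite -h; exact: fw_start.
- by move=> e q [_ qe] h; case: qe; rewrite -h; exact: fw_start.
- by move=> _ h; case: pe; rewrite h; exact: fw_start.
- move=> e' q [qI qe] h.
  have ee' : e = e'.
    apply: (key_cycle (b := tgt e) (p := p) (p' := q)) => //.
    + by left.
    + by left.
    + by rewrite h.
  subst e'; congr existT; congr fw_fwd; apply: existT_inj.
  exact: IH.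
- move=> e' q [qI qe] h.
  have ee' : e = e'.
    apply: (key_cycle (b := tgt e) (p := p) (p' := q)) => //.
    + by left.
    + by right.
    + by rewrite h.
  by subst e'; case: (@no_loop e).
- by move=> _ h; case: pe; rewrite h; exact: fw_start.
- move=> e' q [qI qe] h.
  have ee' : e = e'.
    apply: (key_cycle (b := src e) (p := p) (p' := q)) => //.
    + by right.
    + by left.
    + by rewrite h.
  by subst e'; case: (@no_loop e).
- move=> e' q [qI qe] h.
  have ee' : e = e'.
    apply: (key_cycle (b := src e) (p := p) (p' := q)) => //.
    + by right.
    + by right.
    + by rewrite h.
  subst e'; congr existT; congr fw_bwd; apply: existT_inj.
  exact: IH.
Qed.

Lemma fw_uniq i j (p q : fwalk i j) :
  fw_injective p -> fw_injective q -> p = q.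
Proof. by move=> pI qI; apply: existT_inj; exact: fw_uniq_sig. Qed.

Lemma fw_exists i j : exists p : fwalk i j, fw_injective p.
Proof.
have [p _] := (treeP Q).1.2 i j I I.
by have [q []] := fw_reduce p; exists q.
Qed.

(* The injective walks to the two ends of an arrow differ by that arrow. *)
Lemma fw_step i e (p : fwalk i (src e)) : fw_injective p ->
  (fw_injective (fw_fwd p)) \/
  (exists2 q : fwalk i (tgt e), fw_injective (fw_bwd q) & p = fw_bwd q).
Proof.
move=> pI; have [h|h] := pselect (fw_vertices p (tgt e)); last by left.
right; have [q [qI _ _ _ qn]] := fw_trunc pI h.
have qI' : fw_injective (fw_bwd q).
  by split => //; apply: qn => te; exact: no_loop (esym te).
by exists q => //; exact: fw_uniq.
Qed.

Definition gate (A : set Q) i j : Prop :=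
  A j /\ exists2 p : fwalk j i, fw_injective p &
    forall v, fw_vertices p v -> A v -> v = j.

Lemma closest_gate A i j : closest A i j -> gate A i j.
Proof.
move=> [Aj [p pm]]; split => //; have [q [qI _ _ ql]] := fw_reduce p.
exists q => // v qv Av; apply: contrapT => vj.
have [r [_ _ /(_ vj) rl]] := fw_suffix qv.
have := pm _ r Av; rewrite leqNgt => /negP; apply.
exact: leq_trans rl ql.
Qed.

Lemma closest_ex (A : set Q) i : A !=set0 -> exists j, closest A i j.
Proof.
move=> [j0 Aj0]; have [p0 _] := fw_exists j0 i.
pose P m := `[< exists j (p : fwalk j i), A j /\ fw_length p = m >].
have exP : exists m, P m by exists (fw_length p0); apply/asboolP; exists j0, p0.
have := ex_minnP exP => -[m /asboolP[j [p [Aj pm]]] min].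
exists j; split => //; exists p => j' q Aj'; rewrite pm; apply: min.
by apply/asboolP; exists j', q.
Qed.

Lemma gate_uniq (w : walk Q) i j j' :
  gate (walk_vertices w) i j -> gate (walk_vertices w) i j' -> j = j'.
Proof.
move=> [Aj [p pI pA]] [Aj' [p' pI' pA']].
have [r0 r0A] := walk_connected Aj' Aj.
have [r [rI rv _ _]] := fw_reduce r0.
have cI : fw_injective (fw_cat r p).
  by apply: fw_cat_injective => // v /rv/r0A Av pv; exact: pA.
apply: pA' => //; rewrite -(fw_uniq cI pI') fw_vertices_cat.
by right; exact: fw_start.
Qed.

Lemma gate_step (A : set Q) e j : ~ A (tgt e) -> gate A (src e) j ->
  gate A (tgt e) j.
Proof.
move=> At [Aj [p pI pA]]; split => //.
have [h|[q qI pq]] := fw_step pI.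
  by exists (fw_fwd p) => // v /= [/pA//|->].
exists q; first by case: qI.
by move=> v qv; apply: pA; rewrite pq; left.
Qed.

End TreeFacts.

Section SubspaceFacts.
Variables (k : fieldType) (V : lmodType k).

Lemma submod_closedP (A : set V) :
  A 0 -> (forall a x y, A x -> A y -> A (a *: x + y)) -> submod_closed [in A].
Proof.
move=> A0 AZ; split=> [|a x y /set_mem Ax /set_mem Ay]; apply: mem_set => //.
exact: AZ.
Qed.

Lemma submod0 (A : set V) : submod_closed [in A] -> A 0.
Proof. by move=> [/set_mem]. Qed.

Lemma submodZ (A : set V) a x y : submod_closed [in A] ->
  A x -> A y -> A (a *: x + y).
Proof.
by move=> [_ AZ] Ax Ay; apply: set_mem; apply: AZ; exact: mem_set.
Qed.

Lemma submod_setT : submod_closed [in [set: V]].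
Proof. exact: submod_closedP. Qed.

Lemma submod_set0 : submod_closed [in [set (0 : V)]].
Proof. by apply: submod_closedP => //= a x y -> ->; rewrite scaler0 addr0. Qed.

End SubspaceFacts.

Section LinearImages.
Variables (k : fieldType) (V W : lmodType k) (f : {linear V -> W}).

Lemma submod_image (A : set V) :
  submod_closed [in A] -> submod_closed [in f @` A].
Proof.
move=> Acl; apply: submod_closedP; first by exists 0; [exact: submod0|exact: linear0].
move=> a _ _ [x Ax <-] [y Ay <-]; exists (a *: x + y); last exact: linearP.
exact: submodZ.
Qed.

Lemma submod_preimage (A : set W) : submod_closed [in A] ->
  submod_closed [in f @^-1` A].
Proof.
move=> [/set_mem A0 AZ]; apply: submod_closedP; first by rewrite /preimage/= linear0.
move=> a x y Ax Ay; rewrite /preimage/= linearP; apply: set_mem.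
by apply: AZ; exact: mem_set.
Qed.

End LinearImages.

Section Filtration.
Variables (k : fieldType) (Q : tree) (V : rep k Q).

Lemma transport_closed i (U : set (V i)) j :
  submod_closed [in U] -> submod_closed [in transport V U j].
Proof.
move=> Ucl; have H l (p : fwalk i l) : submod_closed [in transport_along U p].
  elim: p => [//|e p IH|e p IH] /=; first exact: submod_image.
  exact: submod_preimage.
have [p pI] := fw_exists i j.
suff -> : transport V U j = transport_along U p by [].
apply/seteqP; split => [y [q qI]|y py]; last by exists p.
by rewrite (fw_uniq qI pI).
Qed.

Lemma transport_self i (U : set (V i)) : transport V U i = U.
Proof.
apply/seteqP; split => [y [q qI]|y Uy]; last by exists fw_nil.
by rewrite (fw_uniq qI (I : fw_injective fw_nil)).
Qed.

Lemma transport_stable i (U : set (V i)) e x :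
  transport V U (src e) x -> transport V U (tgt e) (rep_map V e x).
Proof.
move=> [p pI px]; have [h|[q [qI _] pq]] := fw_step pI.
  by exists (fw_fwd p) => //; exists x.
by exists q => //; rewrite pq in px.
Qed.

Lemma arrow_plus_closed e i : submod_closed [in arrow_plus V e i].
Proof.
rewrite /arrow_plus; case: asboolP => _; first exact: submod_setT.
by apply: transport_closed; exact: submod_setT.
Qed.

Lemma arrow_plus_stable e a x : arrow_plus V e (src a) x ->
  arrow_plus V e (tgt a) (rep_map V a x).
Proof.
rewrite /arrow_plus; case: asboolP => [[p pe]|_]; case: asboolP => // bt.
  move=> _; have [ae|ae] := pselect (a = e).
    by subst a; rewrite transport_self.
  by case: bt; exists (fw_fwd p) => -[|/esym].
exact: transport_stable.
Qed.

Lemma arrow_minus_closed e i : submod_closed [in arrow_minus V e i].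
Proof.
rewrite /arrow_minus; case: asboolP => _; first exact: submod_set0.
by apply: transport_closed; exact: submod_set0.
Qed.

Lemma arrow_minus_stable e a x : arrow_minus V e (src a) x ->
  arrow_minus V e (tgt a) (rep_map V a x).
Proof.
rewrite /arrow_minus; case: asboolP => [[p pe]|bs].
  move=> ->; rewrite linear0; case: asboolP => // _.
  by apply: submod0; apply: transport_closed; exact: submod_set0.
move=> /transport_stable h; case: asboolP => // -[p pe].
have [ae|ae] := pselect (a = e); last first.
  by case: bs; exists (fw_bwd p) => -[|/esym].
by subst a; rewrite transport_self in h.
Qed.

Lemma virtual_plusE (E : varrow Q) i j : ~ walk_vertices E i ->
  closest (walk_vertices E) i j ->
  virtual_plus V E i = transport V [set: V j] i.
Proof.
rewrite /virtual_plus; case: asboolP => // _ _ cj.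
apply/seteqP; split => [y [j' cj' y']|y yj]; last by exists j.
by rewrite (gate_uniq (closest_gate cj) (closest_gate cj')).
Qed.

Lemma virtual_nonempty (E : varrow Q) : walk_vertices E !=set0.
Proof. by have [[m mE _] _ _ _] := varrowP E; exists (E m), m. Qed.

Lemma virtual_plus_closed E i : submod_closed [in virtual_plus V E i].
Proof.
have [h|h] := pselect (walk_vertices E i).
  by rewrite /virtual_plus; case: asboolP => // _; exact: submod_setT.
have [j cj] := closest_ex i (virtual_nonempty E).
by rewrite (virtual_plusE h cj); apply: transport_closed; exact: submod_setT.
Qed.

Lemma virtual_plus_stable E a x : virtual_plus V E (src a) x ->
  virtual_plus V E (tgt a) (rep_map V a x).
Proof.
have [ht|ht] := pselect (walk_vertices E (tgt a)).
  by rewrite {2}/virtual_plus; case: asboolP.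
have [j cj] := closest_ex (tgt a) (virtual_nonempty E).
rewrite (virtual_plusE ht cj).
have [hs|hs] := pselect (walk_vertices E (src a)).
  have -> : j = src a.
    apply: gate_uniq (closest_gate cj) _; apply: gate_step => //.
    by split => //; exists fw_nil.
  by move=> _; apply: transport_stable; rewrite transport_self.
have [j' cj'] := closest_ex (src a) (virtual_nonempty E).
rewrite (virtual_plusE hs cj').
have -> : j = j'.
  apply: gate_uniq (closest_gate cj) _; apply: gate_step => //.
  exact: closest_gate.
exact: transport_stable.
Qed.

Lemma filtration_closed a i : submod_closed [in filtration_set V a i].
Proof.
apply: submod_closedP.
  split; [split|] => e ae; apply: submod0.
  - exact: arrow_plus_closed.
  - exact: arrow_minus_closed.
  - exact: virtual_plus_closed.
move=> c x y [[x1 x2] x3] [[y1 y2] y3].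
split; [split|] => e ae; apply: submodZ; do ?[exact: x1|exact: x2|exact: x3
  |exact: y1|exact: y2|exact: y3].
- exact: arrow_plus_closed.
- exact: arrow_minus_closed.
- exact: virtual_plus_closed.
Qed.

Lemma filtration_stable a e x : filtration_set V a (src e) x ->
  filtration_set V a (tgt e) (rep_map V e x).
Proof.
move=> [[x1 x2] x3]; split; [split|] => e' ae'.
- by apply: arrow_plus_stable; exact: x1.
- by apply: arrow_minus_stable; exact: x2.
- by apply: virtual_plus_stable; exact: x3.
Qed.

Definition filtration (a : csub Q) : subrep V :=
  SubRep (filtration_closed a) (@filtration_stable a).

Definition sum_set (I : Type) (P : set I) (G : I -> subrep V) (i : Q) :
    set (V i) :=
  [set x | exists n (b : 'I_n -> I) (y : 'I_n -> V i),
    (forall m, P (b m) /\ G (b m) i (y m)) /\ x = \sum_m y m].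
Arguments sum_set {I} P G i _.

Lemma sum_closed (I : Type) (P : set I) (G : I -> subrep V) i :
  submod_closed [in sum_set P G i].
Proof.
apply: submod_closedP.
  exists 0%N, (fun m : 'I_0 => False_rect _ (notF (valP m))), (fun=> 0).
  by split; [case|rewrite big_ord0].
move=> a _ _ [n [b [y [h ->]]]] [n' [b' [y' [h' ->]]]].
exists (n + n')%N,
  (fun m => match fintype.split m with inl l => b l | inr l => b' l end),
  (fun m => match fintype.split m with inl l => a *: y l | inr l => y' l end).
split=> [m|].
  case: (fintype.split m) => l; last exact: h'.
  have [? yl] := h l; split => //; rewrite -[_ *: _]addr0.
  by apply: submodZ => //; [|apply: submod0]; exact: subrep_closed.
rewrite big_split_ord scaler_sumr /=; congr (_ + _); apply: eq_bigr => l _.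
  by rewrite (unsplitK (inl l)).
by rewrite (unsplitK (inr l)).
Qed.

Lemma sum_stable (I : Type) (P : set I) (G : I -> subrep V) e x :
  sum_set P G (src e) x -> sum_set P G (tgt e) (rep_map V e x).
Proof.
move=> [n [b [y [h ->]]]]; exists n, b, (fun m => rep_map V e (y m)).
split=> [m|]; last by rewrite linear_sum.
by have [? ?] := h m; split => //; exact: subrep_stable.
Qed.

Definition sum_subrep (I : Type) (P : set I) (G : I -> subrep V) : subrep V :=
  SubRep (sum_closed P G) (@sum_stable I P G).

Definition filtration_lt (a : csub Q) : subrep V :=
  sum_subrep [set b | csub_lt b a] filtration.

Definition almost_gradation (C : csub Q -> subrep V) : Prop :=
  forall a, internal_dsum (filtration a) (C a) (filtration_lt a).

Definition graded_quotient (a : csub Q) : rep k Q :=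
  quot_rep (sub_in (filtration a) (filtration_lt a)).

Definition graded_quotient_map (a : csub Q) :
    rep_hom (subrep_rep (filtration a)) (graded_quotient a) :=
  quot_hom (sub_in (filtration a) (filtration_lt a)).

End Filtration.

Arguments filtration {k Q} V a.
Arguments filtration_lt {k Q} V a.
Arguments almost_gradation {k Q V} C.
Arguments graded_quotient {k Q} V a.
Arguments graded_quotient_map {k Q} V a.

(* Main.v *)
From HB Require Import structures.
Require Import Defs.
From Stdlib Require Import Relation_Operators.
From mathcomp Require Import all_boot all_order all_algebra.
From mathcomp Require Import boolp classical_sets functions cardinality.

(** Write F for the filtration subspaces of a fixed connected subquiver a, and N
    for the sum of those of the smaller subquivers, and let W = F / N.  Three
    facts make the lift a matter of moving one choice around the tree.

    - W vanishes at the vertices outside a ([filtration_support]).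
    - W is injective along each arrow of a ([filtration_inj]).
    - F is surjective along each arrow of a ([filtration_onto]); this is where
      the hypothesis on virtual arrows enters.

    Indeed, choose a complement of N in F at one vertex of a and move along the
    injective walks in a.  Crossing an arrow forwards, take the image: it spans
    by surjectivity and meets N in 0 by injectivity.  Crossing it backwards, take
    a complement of N inside the preimage in F: the preimage is large enough
    because F is surjective along the arrow.  Outside a the complement is 0, and
    arrows leaving a kill F.  The resulting subspaces form a subrepresentation,
    and a complementary subrepresentation is the same thing as a section of the
    quotient map.

    Surjectivity.  Let e be an arrow of a.  A condition defining F that lives in
    front of e holds at the source of e as soon as it holds at the target,
    because there it is a preimage.  A condition that lives behind e lifts on its
    own, because at the target it is an image; several of them at once need not
    lift.  But two conditions behind e that differ would produce two different
    virtual arrows behind e: one far beyond each boundary arrow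
    ([side_virtual]), or the virtual boundary arrow itself.

    Support.  Let i be a vertex outside a.  If the first arrow from a towards i
    points out of a, then F is 0 at i.  If it points into a, enlarge a by
    everything that can be reached by directed walks from the source of that
    arrow.  The new boundary arrows point inwards, and at i their conditions, as
    well as those of the new virtual boundary arrows, follow from a condition on
    the far side of a ([filtration_reach], [filtration_enlarge]).  So F at i lies
    in a smaller filtration subspace whose subquiver is nearer to i.

    Injectivity.  Let x lie in F at the source of e, with image in N.  If b < a
    contains the target of e it contains the source ([csub_lt_src]), so that all
    terms of the image lift to N, by surjectivity for b instead of a; what
    remains of x is in the kernel of e, which is in the filtration subspace of
    the part of a behind e.

    Everything about transports rests on one family of subspaces, [reach V j i],
    the transport to i of the whole space at j: it only shrinks when the walk
    from j to i gets longer, and it grows when j moves along an arrow. *)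

Set Implicit Arguments.
Unset Strict Implicit.
Unset Printing Implicit Defensive.

Import Order.TTheory GRing.Theory Num.Theory.
Local Open Scope classical_set_scope.
Local Open Scope ring_scope.

(** * The two sides of an arrow of a tree *)

Section Sides.
Variable Q : tree.
Implicit Types (i j : Q) (e : arrow Q) (b : bool) (A : set Q).

(** The boolean is an orientation of the arrow: [true] looks towards its target.
    It lets one statement serve for both directions. *)
Definition side e b : set Q := if b then in_front e else behind e.

Definition tip e b : Q := if b then tgt e else src e.

Lemma side_tip e b : side e b (tip e b).
Proof. by case: b; exists fw_nil => -[]. Qed.

Lemma side_walk e b i j (p : fwalk i j) :
  ~ fw_arrows p e -> side e b i -> side e b j.
Proof.
by case: b => pe [q qe]; exists (fw_cat q p); rewrite fw_arrows_cat => -[].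
Qed.

Lemma side_disjoint e b i : side e b i -> ~ side e (~~ b) i.
Proof.
suff H : in_front e i -> behind e i -> False by case: b => ? ?; apply: H.
move=> [p pe] [q qe].
have : fw_arrows (fw_cat p (fw_rev q)) e by apply: no_detour; right.
by rewrite fw_arrows_cat fw_arrows_rev => -[].
Qed.

Lemma side_step e e' b : e' <> e -> side e b (src e') <-> side e b (tgt e').
Proof.
move=> ne; split.
  by apply: (@side_walk e b _ _ (fw_fwd fw_nil)) => -[|/esym].
by apply: (@side_walk e b _ _ (fw_bwd fw_nil)) => -[|/esym].
Qed.

Lemma side_total e b i : side e b i \/ side e (~~ b) i.
Proof.
suff : side e true i \/ side e false i.
  by case: b => -[]; [left|right|right|left].
have [p _] := fw_exists (tgt e) i; elim: p => [|e' p IH|e' p IH].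
- by left; exact: (side_tip e true).
- have [->|ne] := pselect (e' = e); first by left; exact: (side_tip e true).
  by case: IH => /(side_step _ ne); [left|right].
- have [->|ne] := pselect (e' = e); first by right; exact: (side_tip e false).
  by case: IH => /(side_step _ ne); [left|right].
Qed.

Lemma side_walk_vertices e b i j (p : fwalk i j) :
  ~ fw_arrows p e -> side e b i -> fw_vertices p `<=` side e b.
Proof.
elim: p => [_ ei _ ->//|e' p IH pe ei v [pv|->]|e' p IH pe ei v [pv|->]].
- by apply: IH pv => // h; apply: pe; left.
- exact: side_walk pe ei.
- by apply: IH pv => // h; apply: pe; left.
- exact: side_walk pe ei.
Qed.

Lemma side_connected e b : connected_full (side e b).
Proof.
split; first by exists (tip e b); exact: side_tip.
move=> i j ei ej.
suff [p pe] : exists p : fwalk i j, ~ fw_arrows p e.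
  by exists p; exact: side_walk_vertices.
move: ei ej; case: b => -[p pe] [q qe]; exists (fw_cat (fw_rev p) q);
by rewrite fw_arrows_cat fw_arrows_rev => -[].
Qed.

(** A connected set that does not contain both ends of an arrow is never split
    by it: a walk crossing the arrow would visit both ends. *)
Lemma connected_side A e b i : connected_full A ->
  ~ (A (src e) /\ A (tgt e)) -> A i -> side e b i -> A `<=` side e b.
Proof.
move=> [_ Ac] Ae Ai ei j Aj; have [p pA] := Ac _ _ Ai Aj.
apply: (side_walk (p := p)) ei => /fw_arrow_ends[/pA es /pA et].
exact: Ae.
Qed.

Lemma connected_convex A i j (p : fwalk i j) : connected_full A ->
  fw_injective p -> A i -> A j -> fw_vertices p `<=` A.
Proof.
move=> [_ Ac] pI Ai Aj; have [q qA] := Ac _ _ Ai Aj.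
have [r [rI rq _ _]] := fw_reduce q.
by rewrite (fw_uniq pI rI) => v /rq/qA.
Qed.

Lemma varrow_connected (E : varrow Q) : connected_full (walk_vertices E).
Proof. by split; [exact: virtual_nonempty|exact: walk_connected]. Qed.

(** The side of [e'] that does not contain [e] is connected without [e], so it
    lies where [e'] does. *)
Lemma side_sub e b e' b' : e' <> e -> side e b (tip e' b') ->
  side e' (~~ b') (tip e b) -> side e' b' `<=` side e b.
Proof.
move=> ne h h'.
apply: (@connected_side _ e b (tip e' b')) => //.
- exact: side_connected.
- move=> [hs ht].
  have hb : side e' b' (tip e b) by case: (b).
  exact: side_disjoint hb h'.
- exact: side_tip.
Qed.

End Sides.

(** * Transports of subspaces *)

Section Transports.
Variables (k : fieldType) (Q : tree) (V : rep k Q).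
Implicit Types (i j : Q) (e : arrow Q) (b : bool).

Lemma transportE i (U : set (V i)) j (p : fwalk i j) :
  fw_injective p -> transport V U j = transport_along U p.
Proof.
move=> pI; apply/seteqP; split=> [y [q qI]|y py]; last by exists p.
by rewrite (fw_uniq qI pI).
Qed.

Lemma transport_along_cat i (U : set (V i)) j l (p : fwalk i j)
    (q : fwalk j l) :
  transport_along U (fw_cat p q) = transport_along (transport_along U p) q.
Proof. by elim: q => //= e q ->. Qed.

(** The injective walk from a vertex in front of [e] to the source of [e] ends by
    crossing [e] backwards. *)
Lemma transport_bwd i (U : set (V i)) e : in_front e i ->
  transport V U (src e) = rep_map V e @^-1` transport V U (tgt e).
Proof.
move=> ei; have [p pI] := fw_exists i (tgt e).
have pI' : fw_injective (fw_bwd p).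
  split => // ps; apply: (@side_disjoint _ e true (src e)).
    apply: (connected_convex (side_connected e true) pI) ps => //.
    exact: (side_tip e true).
  exact: (side_tip e false).
by rewrite (transportE _ pI) (transportE _ pI').
Qed.

Lemma transport_fwd i (U : set (V i)) e : behind e i ->
  transport V U (tgt e) = rep_map V e @` transport V U (src e).
Proof.
move=> ei; have [p pI] := fw_exists i (src e).
have pI' : fw_injective (fw_fwd p).
  split => // ps; apply: (@side_disjoint _ e false (tgt e)).
    apply: (connected_convex (side_connected e false) pI) ps => //.
    exact: (side_tip e false).
  exact: (side_tip e true).
by rewrite (transportE _ pI) (transportE _ pI').
Qed.

Definition reach j i : set (V i) := transport V [set: V j] i.
Arguments reach j i _ : clear implicits.

Lemma reach_self i : reach i i = setT.
Proof. exact: transport_self. Qed.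

(** A transport forgets everything that happened before a vertex [c] of the walk,
    except that it is contained in the transport of the whole space at [c]. *)
Lemma transport_via i (U : set (V i)) c j (p : fwalk i j) : fw_injective p ->
  fw_vertices p c -> transport V U j `<=` reach c j.
Proof.
move=> pI pc; rewrite (transportE _ pI).
suff [q [qI _ pq]] : exists q : fwalk c j, [/\ fw_injective q,
    fw_vertices q `<=` fw_vertices p &
    transport_along U p `<=` transport_along [set: V c] q].
  by rewrite /reach (transportE _ qI).
elim: p pI c pc => [_ c /= ->|e p IH [pI pe] c /= [pc|->]
  |e p IH [pI pe] c /= [pc|->]];
  try by exists fw_nil; split => //= v ->; right.
- have [q [qI qp pq]] := IH pI c pc.
  exists (fw_fwd q); split => /=.
  + by split => // /qp.
  + by move=> v [/qp|]; [left|right].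
  + by move=> x [y /pq yq <-]; exists y.
- have [q [qI qp pq]] := IH pI c pc.
  exists (fw_bwd q); split => /=.
  + by split => // /qp.
  + by move=> v [/qp|]; [left|right].
  + by move=> x /pq.
Qed.

Lemma transport_via0 i (U : set (V i)) c j (p : fwalk i j) :
  submod_closed [in U] -> fw_injective p -> fw_vertices p c ->
  transport V [set (0 : V c)] j `<=` transport V U j.
Proof.
move=> Ucl pI pc; rewrite (transportE _ pI).
suff [q [qI _ pq]] : exists q : fwalk c j, [/\ fw_injective q,
    fw_vertices q `<=` fw_vertices p &
    transport_along [set (0 : V c)] q `<=` transport_along U p].
  by rewrite (transportE _ qI).
have U0 l (p' : fwalk i l) : transport_along U p' 0.
  elim: p' => [|e p' IH|e p' IH] /=; first exact: submod0.
    by exists 0 => //; rewrite linear0.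
  by rewrite linear0.
elim: p pI c pc => [_ c /= ->|e p IH [pI pe] c /= [pc|->]
  |e p IH [pI pe] c /= [pc|->]].
- by exists fw_nil; split => // x /= ->; exact: submod0.
- have [q [qI qp pq]] := IH pI c pc.
  exists (fw_fwd q); split => /=.
  + by split => // /qp.
  + by move=> v [/qp|]; [left|right].
  + by move=> x [y /pq yq <-]; exists y.
- exists fw_nil; split=> [//|v ->|x ->]; first by right.
  exact: (U0 _ (fw_fwd p)).
- have [q [qI qp pq]] := IH pI c pc.
  exists (fw_bwd q); split => /=.
  + by split => // /qp.
  + by move=> v [/qp|]; [left|right].
  + by move=> x /pq.
- exists fw_nil; split=> [//|v ->|x ->]; first by right.
  exact: (U0 _ (fw_bwd p)).
Qed.

Lemma fw_across e b i j (p : fwalk i j) c : side e b i -> side e (~~ b) j ->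
  fw_vertices p (tip e c).
Proof.
move=> ei ej; have [h|pe] := pselect (fw_arrows p e).
  by have [] := fw_arrow_ends h; case: c.
by case: (side_disjoint (side_walk pe ei)).
Qed.

Lemma transport_across e b i (U : set (V i)) c j : side e b i ->
  side e (~~ b) j -> transport V U j `<=` reach (tip e c) j.
Proof.
move=> ei ej; have [p pI] := fw_exists i j.
by apply: (transport_via pI); exact: fw_across ei ej.
Qed.

Lemma transport_across0 e b i (U : set (V i)) c j : submod_closed [in U] ->
  side e b i -> side e (~~ b) j ->
  transport V [set (0 : V (tip e c))] j `<=` transport V U j.
Proof.
move=> Ucl ei ej; have [p pI] := fw_exists i j.
by apply: (transport_via0 Ucl pI); exact: fw_across ei ej.
Qed.

(** If the walk from [src e] to [i] passes through [tgt e] it can only lose by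
    starting earlier.  Otherwise the walk from [tgt e] starts by crossing [e]
    backwards, and the preimage of the whole space is the whole space. *)
Lemma reach_mono e i : reach (src e) i `<=` reach (tgt e) i.
Proof.
have [p pI] := fw_exists (src e) i.
have [pe|pe] := pselect (fw_vertices p (tgt e)).
  exact: transport_via pI pe.
pose q := fw_cat (fw_bwd (fw_nil : fwalk (tgt e) (tgt e))) p.
have qI : fw_injective q.
  apply: fw_cat_injective => //=; first by split => // /no_loop.
  by move=> v [] -> // /pe.
by rewrite /reach (transportE _ pI) (transportE _ qI) transport_along_cat.
Qed.

(** The closest vertex of [E] is on the walk to [i] from any other vertex of [E],
    so the transport from it is the largest. *)
Lemma virtual_plusP (E : varrow Q) i x :
  virtual_plus V E i x <-> exists2 j, walk_vertices E j & reach j i x.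
Proof.
have [Ei|Ei] := pselect (walk_vertices E i).
  split=> _; first by exists i => //; rewrite reach_self.
  by rewrite /virtual_plus; case: asboolP.
have [j cj] := closest_ex i (virtual_nonempty E).
rewrite (virtual_plusE V Ei cj); split=> [xj|[j' Ej' xj']].
  by exists j => //; case: cj.
have [Ej [p pI pA]] := closest_gate cj.
have [r [rI rE _ _]] : exists r : fwalk j' j, [/\ fw_injective r,
    fw_vertices r `<=` walk_vertices E, True & True].
  have [r0 r0E] := walk_connected Ej' Ej.
  by have [r [rI rv _ _]] := fw_reduce r0; exists r; split => // v /rv/r0E.
have cI : fw_injective (fw_cat r p).
  by apply: fw_cat_injective => // v /rE Ev pv; exact: pA.
apply: (transport_via cI _ xj').
by rewrite fw_vertices_cat; right; exact: fw_start.
Qed.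

End Transports.

Arguments reach {k Q} V j i _.

(** * Virtual arrows up to end segments *)

Section VirtualArrows.
Variables (Q : tree).
Implicit Types (A B : set Q) (i j : int).

Lemma end_segment_refl (E : varrow Q) : end_segment E E.
Proof.
exists 0; split=> [i Ei|i j Ei Ej _]; first by rewrite addr0.
rewrite subr0. exact: Ej.
Qed.

(** Unlike the inclusion of an end segment, this form of being eventually in [A]
    passes at once from an end segment to the whole virtual arrow and back. *)
Definition eventually_in (E : varrow Q) (A : set Q) : Prop :=
  exists2 i, i \in walk_dom E & forall j, j \in walk_dom E -> i <= j -> A (E j).

Lemma eventually_in_end (E E' : varrow Q) A :
  end_segment E E' -> eventually_in E A <-> eventually_in E' A.
Proof.
move=> [d [EE' EE'2]]; split=> -[i Ei EA].
  have [Ei' _] := EE' i Ei.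
  exists (i + d) => // j Ej ij.
  have Ejd := EE'2 _ _ Ei Ej ij.
  have [_ h] := EE' _ Ejd; rewrite subrK in h; rewrite -h; apply: EA => //.
  by rewrite lerBrDr.
have [[m Em mmin] _ _ _] := varrowP E.
have [Em' _] := EE' m Em.
have [mi|im] := leP (m + d) i.
  exists (i - d); first exact: EE'2 Em _ _.
  move=> j Ej ij; have [Ejd ->] := EE' j Ej; apply: EA => //.
  by rewrite -lerBlDr.
exists m => // j Ej mj; have [Ejd ->] := EE' j Ej; apply: EA => //.
by apply: le_trans (ltW im) _; rewrite lerD2r.
Qed.

Lemma same_varrow_ind (P : varrow Q -> Prop) :
  (forall E E', end_segment E E' -> P E <-> P E') ->
  forall E E', same_varrow E E' -> P E <-> P E'.
Proof.
move=> PE E E'; elim=> {E E'} [E E' /PE//|//|E E' _ []//|E E' E'' _ h1 _ h2].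
by rewrite h1.
Qed.

Lemma eventually_in_disjoint (E : varrow Q) A B :
  eventually_in E A -> eventually_in E B -> A `&` B !=set0.
Proof.
move=> [i Ei EA] [j Ej EB].
have [ij|/ltW ji] := leP i j.
  by exists (E j); split; [exact: EA|exact: EB].
by exists (E i); split; [exact: EA|exact: EB].
Qed.

Lemma walk_vertices_eventually (E : varrow Q) A :
  walk_vertices E `<=` A -> eventually_in E A.
Proof.
move=> EA; have [[m Em _] _ _ _] := varrowP E.
by exists m => // j Ej _; apply: EA; exists j.
Qed.

Variables (k : fieldType) (V : rep k Q).

Lemma reach_virtual (E : varrow Q) i j (l : Q) :
  i \in walk_dom E -> j \in walk_dom E -> i <= j ->
  reach V (E i) l `<=` reach V (E j) l.
Proof.
move=> Ei Ej ij.
have -> : j = i + `|j - i|%N%:Z.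
  by rewrite gez0_abs ?subr_ge0// addrCA subrr addr0.
have : i + `|j - i|%N%:Z \in walk_dom E.
  by rewrite gez0_abs ?subr_ge0// addrCA subrr addr0.
elim: `|j - i|%N => [|n IH]; first by rewrite addr0 => _ ?.
rewrite -addn1 PoszD addrA => nw.
have {}nw' : i + n%:Z \in walk_dom E.
  by apply: itv_convex Ei nw _; rewrite lerDl /= lerDl.
apply: subset_trans (IH nw') _.
have [_ _ /(_ _ nw' nw)[e [_ _ es et]] _] := varrowP E.
by rewrite -es -et; exact: reach_mono.
Qed.

Lemma virtual_plus_same (E E' : varrow Q) (i : Q) (x : V i) :
  same_varrow E E' -> virtual_plus V E i x <-> virtual_plus V E' i x.
Proof.
move: E E'; apply: (same_varrow_ind (P := fun E => virtual_plus V E i x)).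
move=> E E' [d [EE' EE'2]].
rewrite !virtual_plusP; split=> -[_ [j Ej <-] xj].
  have [Ejd h] := EE' j Ej; exists (E' (j + d)); first by exists (j + d).
  by rewrite -h.
have [[m Em mmin] _ _ _] := varrowP E.
have [Em' h] := EE' m Em.
have [mj|/ltW jm] := leP (m + d) j.
  have Ejd := EE'2 _ _ Em Ej mj.
  exists (E (j - d)); first by exists (j - d).
  by have [_ ->] := EE' _ Ejd; rewrite subrK.
exists (E m); first by exists m.
by rewrite h; exact: reach_virtual xj.
Qed.

End VirtualArrows.

(** * Existence of virtual arrows *)

Section Existence.
Variable Q : tree.
Implicit Types (e : arrow Q) (b : bool).

Lemma leaf_virtual (v : Q) : leaf v ->
  exists E : varrow Q, walk_vertices E = [set v].
Proof.
move=> lv; pose I : interval int := `[0, 0].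
have IE (i : int) : (i \in I) = (i == 0) by rewrite in_itv /= eq_le andbC.
have wP (i : int) : i \in I -> i + 1 \in I -> exists e, joins e v v.
  by rewrite !IE => /eqP ->; rewrite add0r oner_eq0.
pose w := @Walk Q I (fun=> v) wP.
suff wv : is_virtual_arrow w.
  exists (VArrow wv); apply/seteqP; split=> [_ [i _ <-]//|_ ->].
  by exists 0 => //=; rewrite IE.
split.
- by exists 0; rewrite /= ?IE// => i; rewrite IE => /eqP ->.
- by move=> i j /=; rewrite !IE => /eqP -> /eqP ->.
- by move=> i /=; rewrite !IE => /eqP ->; rewrite add0r oner_eq0.
- by right; exists 0; split; rewrite /= ?IE// => i; rewrite IE => /eqP ->.
Qed.

(** The journeys are indexed by integers: [M] is the index from which the
    sequence [v] is read. *)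
Lemma infinite_ray (v : nat -> Q) (s : nat -> arrow Q) (M : nat) :
  injective v -> (forall n, (M <= n)%N -> joins (s n) (v n) (v n.+1)) ->
  exists w : walk Q,
    [/\ walk_dom w = `[M%:Z, +oo[, journey w, walk_injective w &
    forall i, walk_map w i = v (absz i)].
Proof.
move=> vI vs; pose I : interval int := `[M%:Z, +oo[.
have IE (i : int) : (i \in I) = (M%:Z <= i) by rewrite in_itv /= andbT.
have absS (i : int) : i \in I -> absz (i + 1) = (absz i).+1.
  by rewrite IE; case: i => // n _; rewrite -PoszD addn1.
have wP (i : int) : i \in I -> i + 1 \in I ->
    exists e, joins e (v (absz i)) (v (absz (i + 1))).
  move=> Ii _; exists (s (absz i)); rewrite absS//; apply: vs.
  by move: Ii; rewrite IE; case: i.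
exists (@Walk Q I (fun i => v (absz i)) wP); split => //.
  by exists M%:Z; rewrite /= ?IE// => i; rewrite IE.
move=> i j /=; rewrite !IE => Mi Mj /vI.
by case: i Mi => // i _; case: j Mj => // j _ /= ->.
Qed.

(** Walking away from an arrow never comes back, so the walk either stops at a
    leaf or is an infinite journey; in the second case only finitely many of its
    arrows are inconsistent and an end segment of it is a virtual arrow. *)
Lemma side_virtual e b : eventually_outward Q ->
  exists E : varrow Q, walk_vertices E `<=` side e b.
Proof.
move=> eo; have [[l [el ll]]|noleaf] :=
  pselect (exists l, side e b l /\ leaf l).
  by have [E Ev] := leaf_virtual ll; exists E; rewrite Ev => _ ->.
(* A state is the arrow just crossed, with the direction in which it was. *)
pose P (s s' : arrow Q * bool) := ~ leaf (tip s.1 s.2) ->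
  s'.1 <> s.1 /\ tip s'.1 (~~ s'.2) = tip s.1 s.2.
have exP s : exists s', P s s'.
  case: s => e1 b1; have [h|h] := pselect (leaf (tip e1 b1)).
    by exists (e1, b1).
  apply: contrapT => H; apply: h; exists e1; split.
    by case: (b1); [right|left].
  move=> e' e'1; apply: contrapT => ne; apply: H.
  by case: e'1 => h; [exists (e', true)|exists (e', false)].
have [next nextP] := choice exP.
pose s n := iter n next (e, b).
pose R n := side (s n).1 (s n).2.
pose v n := tip (s n).1 (s n).2.
have vR n : R n (v n) by exact: side_tip.
have step n : R n `<=` side e b -> [/\ R n.+1 `<=` R n,
    ~ R n.+1 (v n) & joins (s n.+1).1 (v n) (v n.+1)].
  move=> Rn; have nl : ~ leaf (v n).
    by move=> h; apply: noleaf; exists (v n); split=> //; exact: Rn.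
  have [ne vn] : (s n.+1).1 <> (s n).1 /\ tip (s n.+1).1 (~~ (s n.+1).2) = v n.
    exact: nextP.
  rewrite {2}/R {1 3}/v; split.
  - apply: side_sub => //; last by rewrite -/(v n) -vn; exact: side_tip.
    have := vR n; rewrite /R -vn.
    by case: (s n.+1).2 => /=; rewrite side_step.
  - by rewrite -/(v n) -vn /R => h; exact: side_disjoint h (side_tip _ _).
  - by rewrite -/(v n) -vn /v; case: (s n.+1).2; [left|right].
have Re n : R n `<=` side e b.
  by elim: n => [//|n IH]; have [h _ _] := step n IH; exact: subset_trans h IH.
have RS m n : (m <= n)%N -> R n `<=` R m.
  move=> /subnKC <-; elim: (n - m)%N => [|d IH]; first by rewrite addn0.
  rewrite addnS; have [h _ _] := step _ (Re (m + d)%N).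
  exact: subset_trans h IH.
have vlt m n : (m < n)%N -> v m <> v n.
  move=> mn vmn; have [_ h _] := step _ (Re m); apply: h.
  by rewrite vmn; apply: RS mn _ _.
have vI : injective v.
  by move=> m n vmn; case: (ltngtP m n) => // /vlt; rewrite vmn.
pose a n := (s n.+1).1.
have va n : joins (a n) (v n) (v n.+1) by have [] := step _ (Re n).
have aI : injective a.
  suff H m n : (m < n)%N -> a m <> a n.
    by move=> m n amn; case: (ltngtP m n) => // /H; rewrite amn.
  move=> mn amn; have := va m; have := va n; rewrite amn.
  have h1 : v m <> v n.+1 by apply: vlt; exact: ltnW.
  have h2 : v m.+1 <> v n.+1 by exact: vlt.
  move=> [[x1 x2]|[x1 x2]] [[y1 y2]|[y1 y2]].
  - by apply: h2; rewrite -x2 -y2.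
  - by apply: h1; rewrite -x2 -y2.
  - by apply: h1; rewrite -x1 -y1.
  - by apply: h2; rewrite -x1 -y1.
have [w0 [w0d w0j w0I w0v]] := infinite_ray (M := 0) vI (fun n _ => va n).
(* [r] lists the steps at which the walk goes against an arrow. *)
have := finite_preimage (f := a) (in2W aI) (eo w0 w0j w0I).
move=> /finite_seqP[r rE]; pose M := (\max_(i <- r) i).+1.
have aM n : (M <= n)%N -> src (a n) = v n /\ tgt (a n) = v n.+1.
  move=> Mn; case: (va n) => // -[h1 h2].
  suff : n \in r.
    by move=> /(leq_bigmax_seq (F := id))/(_ erefl); rewrite leqNgt Mn.
  suff : [set` r] n by [].
  rewrite -rE; exists n%:Z; rewrite /inconsistent_at !w0v w0d !in_itv /=.
  by rewrite addn1.
have [w [wd wj wI wv]] := infinite_ray (M := M) vI (fun n _ => va n).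
suff wV : is_virtual_arrow w.
  by exists (VArrow wV) => _ [i _ <-] /=; rewrite wv; apply/Re/vR.
split => //.
- move=> i i1 i2; have := i1; rewrite wd in_itv /= andbT => Mi.
  exists (a (absz i)); rewrite /consistent_at !wv.
  case: i Mi i1 i2 => // n Mn i1 i2; have [h1 h2] := aM n Mn; split=> //=.
  by rewrite addn1.
- left; rewrite wd => fin; apply: infinite_nat.
  have := finite_preimage (f := fun n => (M + n)%N%:Z) _ fin.
  have -> : (fun n => (M + n)%N%:Z) @^-1` [set` `[M%:Z, +oo[] = [set: nat].
    apply/seteqP; split=> // n _ /=.
    by rewrite in_itv /= andbT lez_nat leq_addr.
  by apply=> m n _ _ [] /addnI.
Qed.

End Existence.

(** * Boundary arrows *)

Section Boundary.
Variable Q : tree.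
Implicit Types (i j : Q) (e d : arrow Q) (b c : bool) (a : csub Q).

(** Membership of the two ends is enough: which side of [e] contains [a] follows
    from connectedness.  The boolean points out of [a], so that incoming boundary
    arrows have [false] and outgoing ones [true]. *)
Definition boundary_at a e b : Prop :=
  csub_set a (tip e (~~ b)) /\ ~ csub_set a (tip e b).

Lemma ibaP a e : iba a e <-> boundary_at a e false.
Proof.
split=> [[[[as_ at_]|[as_ at_]//] af]|[at_ as_]].
  case: (@side_disjoint _ e true (src e)); first exact: af.
  exact: (side_tip e false).
split; first by right.
apply: (@connected_side _ _ e true (tgt e)) => //; first exact: csubP.
  by case.
exact: (side_tip e true).
Qed.

Lemma obaP a e : oba a e <-> boundary_at a e true.
Proof.
split=> [[[//|[as_ at_]] af]|[as_ at_]].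
  case: (@side_disjoint _ e false (tgt e)); first exact: af.
  exact: (side_tip e true).
split; first by left.
apply: (@connected_side _ _ e false (src e)) => //; first exact: csubP.
  by case.
exact: (side_tip e false).
Qed.

Lemma boundary_sub a e b : boundary_at a e b -> csub_set a `<=` side e (~~ b).
Proof. by case: b => [/obaP[]|/ibaP[]]. Qed.

Lemma side_tips e b d c c' : d <> e ->
  side e b (tip d c) -> side e b (tip d c').
Proof. by move=> /(side_step b) H; case: c; case: c' => //= /H. Qed.
Arguments side_tips {e b d} c c' _ _.

(** What is beyond a boundary arrow of [a] stays away from [e] when [a] contains
    an end of [e]. *)
Lemma boundary_side a e b b' d c : d <> e -> side e b (tip d c) ->
  csub_set a (tip e b') -> boundary_at a d c -> side d c `<=` side e b.
Proof.
move=> de h ae bd; apply: side_sub => //.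
by apply: (side_tips b') (boundary_sub bd ae); exact/nesym.
Qed.

(** The parts of the tree beyond different boundary arrows are disjoint: each
    boundary arrow is on the side of the other that contains [a]. *)
Lemma boundary_disjoint a d c d' c' : boundary_at a d c ->
  boundary_at a d' c' -> d <> d' -> side d' c' `<=` side d (~~ c).
Proof.
move=> bd bd' dd'; apply: side_sub; first exact/nesym.
  apply: (side_tips (~~ c')); first exact/nesym.
  by apply: (boundary_sub bd); case: bd'.
by apply: (boundary_sub bd'); case: bd.
Qed.

(** A walk that leaves [a] without crossing [e] does so through a boundary arrow
    other than [e]. *)
Lemma boundary_or_sub a e b : csub_set a (tip e b) ->
  (exists d c, [/\ boundary_at a d c, d <> e & side e b (tip d c)]) \/
  side e b `<=` csub_set a.
Proof.
move=> ae; have [|nb] := pselect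
  (exists d c, [/\ boundary_at a d c, d <> e & side e b (tip d c)]).
  by left.
right=> j ej; suff [p pe] : exists p : fwalk (tip e b) j, ~ fw_arrows p e.
  elim: p pe {ej} => [//|d p IH pe|d p IH pe].
  - have {}IH := IH (fun h => pe (or_introl h)).
    apply: contrapT => nt; apply: nb; exists d, true; split => //.
      by move=> de; apply: pe; right.
    exact: side_walk pe (side_tip e b).
  - have {}IH := IH (fun h => pe (or_introl h)).
    apply: contrapT => nt; apply: nb; exists d, false; split => //.
      by move=> de; apply: pe; right.
    exact: side_walk pe (side_tip e b).
by case: b ej {ae nb}.
Qed.

End Boundary.
Arguments side_tips {Q e b d} c c' _ _.

(** * The conditions defining the filtration *)

Section Conditions.
Variables (k : fieldType) (Q : tree) (V : rep k Q).
Implicit Types (i j : Q) (e d : arrow Q) (b c : bool) (a : csub Q).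

Definition boundary_cond d c i : set (V i) :=
  if c then arrow_minus V d i else arrow_plus V d i.
Arguments boundary_cond d c i _ : clear implicits.

Lemma filtrationP a i (x : V i) : filtration V a i x <->
  (forall d c, boundary_at a d c -> boundary_cond d c i x) /\
  (forall E : varrow Q, walk_vertices E `<=` csub_set a ->
    virtual_plus V E i x).
Proof.
split=> [[[x1 x2] x3]|[x1 x2]].
  split=> [d [] bd|E aE]; [apply: x2|apply: x1|exact: x3].
    exact/obaP.
  exact/ibaP.
split; [split|] => [d /ibaP|d /obaP|E aE]; [exact: x1|exact: x1|exact: x2].
Qed.

(** On the side of a boundary arrow that contains [a], both kinds of conditions
    are transports from the target of the arrow: of 0 for an outgoing arrow, of
    the whole space for an incoming one. *)
Definition cond_set c j : set (V j) := if c then [set 0] else setT.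
Arguments cond_set c j _ : clear implicits.

Lemma cond_set_closed c j : submod_closed [in cond_set c j].
Proof. by case: c; [exact: submod_set0|exact: submod_setT]. Qed.

Lemma boundary_condE d c i : side d (~~ c) i ->
  boundary_cond d c i = transport V (cond_set c (tgt d)) i.
Proof.
move=> di; have := side_disjoint di; case: c di => /= di di'.
  by rewrite /arrow_minus; case: asboolP.
by rewrite /arrow_plus; case: asboolP.
Qed.

(** Beyond the end of [e] that lies in [a] there is a boundary arrow of [a], or
    else a virtual arrow inside [a]; its condition is a transport from there, so
    it passes through [e] on its way to [i]. *)
Lemma filtration_reach a e b c i (x : V i) : eventually_outward Q ->
  csub_set a (tip e b) -> side e (~~ b) i -> filtration V a i x ->
  reach V (tip e c) i x.
Proof.
move=> eo ae ei /filtrationP[x1 x2].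
have [[d [c' [bd de ed]]]|sa] := boundary_or_sub ae.
  have := x1 _ _ bd; rewrite boundary_condE.
    exact: (transport_across _ (side_tips c' true de ed) ei).
  apply: (side_sub _ _ _ ei); first exact/nesym.
    apply: (side_tips b); first exact/nesym.
    exact: (boundary_sub bd).
  by rewrite negbK; exact: side_tips de ed.
have [E Es] := side_virtual e b eo.
have /virtual_plusP[j Ej] := x2 E (subset_trans Es sa).
by apply: (transport_across _ _ ei); exact: Es.
Qed.

End Conditions.
Arguments boundary_cond {k Q} V d c i _.
Arguments cond_set {k Q} V c j _.

(** * Monotonicity of the filtration and shape of the order *)

Section Monotone.
Variables (k : fieldType) (Q : tree) (V : rep k Q).
Hypothesis eo : eventually_outward Q.
Implicit Types (i j : Q) (e d : arrow Q) (c : bool) (a b : csub Q).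

Lemma reduction_boundary a a' e d c : csub_set a' = csub_set a `&` behind e ->
  boundary_at a' d c -> d <> e -> boundary_at a d c.
Proof.
rewrite /boundary_at => -> [[d1 d2] d3] de.
split => // d4; apply: d3; split => //.
exact: (@side_tips _ e false d (~~ c)).
Qed.

Lemma enhancement_boundary a a' e d c :
  csub_set a = csub_set a' `&` in_front e ->
  boundary_at a d c -> d <> e -> boundary_at a' d c.
Proof.
rewrite /boundary_at => -> [[d1 d2] d3] de.
split => // d4; apply: d3; split => //.
exact: (@side_tips _ e true d (~~ c)).
Qed.

(** The outgoing boundary arrow [e] of [a'] makes the filtration zero in front of
    [e], and behind [e] it forces the transport of 0 through [e], which is
    contained in every condition coming from in front of [e]. *)
Lemma filtration_reduction a a' i : reduction a a' ->
  filtration V a' i `<=` filtration V a i.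
Proof.
move=> [e [aes aet] a'E] x /filtrationP[x1 x2].
have bd : boundary_at a' e true.
  rewrite /boundary_at a'E; split.
    by split=> //; exact: (side_tip e false).
  by move=> [_]; exact: (side_disjoint (side_tip e true)).
have [ei|ei] := side_total e true i.
  have -> : x = 0.
    have := x1 _ _ bd; rewrite /= /arrow_minus; case: asboolP => [_ //|nf].
    by case: nf.
  by apply: submod0; exact: filtration_closed.
have x0 : transport V [set (0 : V (tgt e))] i x.
  by rewrite -/(cond_set V true (tgt e)) -boundary_condE//; exact: x1.
have across (j : Q) (U : set (V j)) : submod_closed [in U] -> in_front e j ->
    transport V U i x.
  move=> Ucl ej.
  exact: (@transport_across0 k Q V e true j U true i Ucl ej ei _ x0).
apply/filtrationP; split=> [d c bd'|E aE].
  have de : d <> e by move=> de; case: bd'; rewrite de; case: (c).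
  have [ed|ed] := side_total e true (tip d c); last first.
    apply: x1; rewrite /boundary_at a'E; case: bd' => h1 h2.
    split; last by case.
    by split => //; exact: (@side_tips _ e false d c).
  rewrite boundary_condE; last first.
    apply: (side_sub (b' := false) _ _ _ ei); first exact/nesym.
      exact: (boundary_sub bd').
    exact: side_tips de ed.
  apply: across; first exact: cond_set_closed.
  exact: (side_tips c true de ed).
have [Ea'|] := pselect (walk_vertices E `<=` csub_set a'); first exact: x2.
move=> /existsNP[j /not_implyP[Ej a'j]].
have ej : in_front e j.
  have [//|ej] := side_total e true j.
  by case: a'j; rewrite a'E; split=> //; exact: aE.
by apply/virtual_plusP; exists j => //; apply: across => //; exact: submod_setT.
Qed.

(** The only condition for [a] that is not one for [a'] comes from [e]; it is
    implied by any condition for [a'] that comes from behind [e]. *)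
Lemma filtration_enhancement a a' i : enhancement a a' ->
  filtration V a' i `<=` filtration V a i.
Proof.
move=> [e [aes aet] aE] x xa'; have /filtrationP[x1 x2] := xa'.
apply/filtrationP; split=> [d c bd|E aE']; last first.
  by apply: x2 => j /aE'; rewrite aE => -[].
have [de|de] := pselect (d = e).
  2: by apply: x1; exact: enhancement_boundary bd de.
subst d; case: c bd => bd.
  by case: bd; rewrite aE => _ []; split => //; exact: (side_tip e true).
rewrite /= /arrow_plus; case: asboolP => // nb.
have [ei|//] := side_total e true i.
by apply: (filtration_reach (b := false) true eo) xa'.
Qed.

Lemma filtration_mono a b i : csub_lt b a ->
  filtration V b i `<=` filtration V a i.
Proof.
elim=> {a b} [a b []|a b b' _ h1 _ h2].
- exact: filtration_reduction.
- exact: filtration_enhancement.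
- exact: subset_trans h2 h1.
Qed.

Lemma filtration_lt_in a b i : csub_lt b a ->
  filtration V b i `<=` filtration_lt V a i.
Proof.
move=> ba x bx; exists 1%N, (fun=> b), (fun=> x).
by rewrite big_ord1; split.
Qed.

Lemma filtration_lt_sub a i : filtration_lt V a i `<=` filtration V a i.
Proof.
move=> _ [n [b [y [by_ ->]]]]; have Fcl := filtration_closed V a i.
apply: (big_ind (fun x => filtration V a i x)).
- exact: submod0.
- by move=> x x' ax ax'; rewrite -[x]scale1r; exact: submodZ.
- by move=> m _; have [h] := by_ m; exact: filtration_mono.
Qed.

(** The conclusion holds for [b = a] and survives every move.  A reduction
    creates no incoming boundary arrow.  An enhancement behind [d] only creates
    incoming boundary arrows that have [d], hence everything in front of [d], in
    front of them; and [a] was in front of [d], as [d] was an incoming boundary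
    arrow. *)
Lemma csub_lt_iba a b e : csub_lt b a -> iba b e -> csub_set a `<=` in_front e.
Proof.
pose Inv (b : csub Q) := forall e, iba b e -> csub_set a `<=` in_front e.
move=> ba; suff : Inv b by apply.
have : Inv a by move=> ? [].
elim: ba => {b} [x y [] [d [ds dt] E]|x y z _ h1 _ h2 /h1/h2//] Ix {e} e.
  move=> /ibaP ye; apply/Ix/ibaP; apply: (reduction_boundary E ye) => ed.
  by subst e; case: ye; rewrite E => -[_ /(side_disjoint (side_tip d true))].
move=> /ibaP ye.
have [ed|ed] := side_total d true (tgt e).
  have ne : e <> d by move=> ed'; subst e; case: ye.
  apply/Ix/ibaP; rewrite /boundary_at E; case: ye => y1 y2; split; last by case.
  by split.
have ad : csub_set a `<=` in_front d.
  apply/Ix/ibaP; rewrite /boundary_at E; split.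
    by split=> //; exact: (side_tip d true).
  by move=> [_] /(side_disjoint (side_tip d false)).
have ne : e <> d by move=> ed'; subst e; case: ye.
apply: subset_trans ad _.
apply: (@side_sub _ e true d true); first exact/nesym.
  exact: (boundary_sub ye).
exact: ed.
Qed.

Lemma csub_lt_src a b e : csub_lt b a -> arrow_in a e ->
  csub_set b (tgt e) -> csub_set b (src e).
Proof.
move=> ba [as_ at_] bt; apply: contrapT => bs.
have /(csub_lt_iba ba)/(_ _ as_) : iba b e by exact/ibaP.
exact: (side_disjoint (side_tip e false)).
Qed.

End Monotone.

(** * Enlarging a subquiver behind a boundary arrow *)

Section Outflow.
Variable Q : tree.
Implicit Types (i j : Q) (e d : arrow Q) (A : set Q).

(** The vertices reached from [src d] by directed walks that avoid [d]. *)
Inductive outflow d : Q -> Prop :=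
| outflow_src : outflow d (src d)
| outflow_step e : e <> d -> outflow d (src e) -> outflow d (tgt e).

Lemma outflow_behind d : outflow d `<=` behind d.
Proof.
move=> j; elim=> [|e ed _]; first exact: (side_tip d false).
exact: (iffLR (side_step false ed)).
Qed.

Lemma fw_vertices_rev i j (p : fwalk i j) :
  fw_vertices (fw_rev p) = fw_vertices p.
Proof.
elim: p => [//|e q IH|e q IH] /=; rewrite fw_vertices_cat IH /=.
all: apply/seteqP; split=> [v [[->|->]|qv]|v [qv|->]].
all: by [right|left; exact: fw_end|left|left; left|right].
Qed.

Lemma star_connected A h : A h ->
  (forall i, A i -> exists p : fwalk h i, fw_vertices p `<=` A) ->
  connected_full A.
Proof.
move=> Ah AP; split; first by exists h.
move=> i j /AP[p pA] /AP[q qA]; exists (fw_cat (fw_rev p) q).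
by rewrite fw_vertices_cat fw_vertices_rev => v [/pA|/qA].
Qed.

Lemma outflow_connected (a : csub Q) d : iba a d ->
  connected_full (csub_set a `|` outflow d).
Proof.
move=> /ibaP[at_ as_]; apply: (@star_connected _ (src d)).
  by right; exact: outflow_src.
move=> i [ai|]; last first.
  elim=> [|e ed se [p pA]].
    by exists fw_nil => v ->; right; exact: outflow_src.
  exists (fw_fwd p) => v [/pA//|->]; right; exact: outflow_step.
have [p pA] := (csubP a).2 _ _ at_ ai.
exists (fw_cat (fw_fwd fw_nil) p).
rewrite fw_vertices_cat => v /= [[->|->]|/pA].
- by right; exact: outflow_src.
- by left.
- by left.
Qed.

End Outflow.

(** * Support, surjectivity and injectivity *)

Section Support.
Variables (k : fieldType) (Q : tree) (V : rep k Q).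
Hypothesis eo : eventually_outward Q.
Implicit Types (i j : Q) (e d : arrow Q) (c : bool) (a b : csub Q).

Lemma reach_outflow d i j : behind d i -> outflow d j ->
  reach V (tgt d) i `<=` reach V j i.
Proof.
move=> di; elim=> [|e ed _ IH]; last by move=> x /IH; exact: reach_mono.
apply: (@transport_across _ _ _ d true _ _ false) => //.
exact: (side_tip d true).
Qed.

(** Adding the outflow of [src d] creates boundary arrows that all point
    inwards.  Their conditions, and those of the new virtual boundary arrows, are
    transports from vertices of the outflow, so they are weaker at [i] than the
    transport from [tgt d], by [reach_outflow]. *)
Lemma filtration_enlarge a d i : iba a d -> behind d i ->
  exists b, [/\ csub_lt b a, csub_set a `<=` csub_set b, csub_set b (src d) &
    filtration V a i `<=` filtration V b i].
Proof.
move=> ad di; have [at_ as_] : boundary_at a d false by exact/ibaP.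
have af : csub_set a `<=` in_front d by case: ad.
exists (CSub (outflow_connected ad)); split.
- apply: t_step; right; exists d => /=.
    by split; [right; exact: outflow_src|left].
  apply/seteqP; split=> [j aj|j].
    2: by move=> [[//|/outflow_behind dj] /(side_disjoint (b := true))].
  by split; [left|exact: af].
- by move=> j; left.
- by right; exact: outflow_src.
move=> x xa; have /filtrationP[x1 x2] := xa.
have xt : reach V (tgt d) i x.
  exact: (filtration_reach (b := true) true eo at_ di xa).
apply/filtrationP; split=> [e c|E aE].
  rewrite /boundary_at /= => -[h1 h2].
  have [ae|nae] := pselect (csub_set a (tip e (~~ c))).
    by apply: x1; split => // h; apply: h2; left.
  have oe : outflow d (tip e (~~ c)) by case: h1.
  case: c h1 h2 nae oe => /= h1 h2 nae oe.
    case: h2; have [ed|ed] := pselect (e = d); first by left; rewrite ed.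
    by right; exact: outflow_step.
  rewrite /arrow_plus; case: asboolP => // _.
  exact: (reach_outflow di oe).
have [aE'|/existsNP[j /not_implyP[Ej aj]]] :=
  pselect (walk_vertices E `<=` csub_set a).
  exact: x2.
apply/virtual_plusP; exists j => //; apply: (reach_outflow di) xt.
by case: (aE j Ej).
Qed.

(** Induction along the injective walk from [i] to [a]: crossing its last arrow
    either leaves nothing at [i] or permits an enlargement that contains one more
    vertex of the walk. *)
Lemma filtration_support a i x : filtration V a i x -> x = 0 \/
  exists b, [/\ b = a \/ csub_lt b a, csub_set b i & filtration V b i x].
Proof.
have [[j aj] _] := csubP a; have [p pI] := fw_exists i j.
elim: p a aj pI => [|e p IH|e p IH] a aj.
- by move=> _ xa; right; exists a; split => //; left.
- move=> [pI pe] xa; have [ae|ae] := pselect (csub_set a (src e)).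
    exact: IH ae pI xa.
  have ie : iba a e by exact/ibaP.
  have ei : behind e i.
    have h : ~ fw_arrows (fw_rev p) e.
      by rewrite fw_arrows_rev => /fw_arrow_ends[].
    exact: (side_walk (b := false) h (side_tip e false)).
  have [b [ba ab be xb]] := filtration_enlarge ie ei.
  have [->|[b' [b'b b'i xb']]] := IH b be pI (xb _ xa); first by left.
  right; exists b'; split => //; right.
  by case: b'b => [->//|b'b]; exact: t_trans ba b'b.
- move=> [pI pe] xa; have [ae|ae] := pselect (csub_set a (tgt e)).
    exact: IH ae pI xa.
  have ei : in_front e i.
    have h : ~ fw_arrows (fw_rev p) e.
      by rewrite fw_arrows_rev => /fw_arrow_ends[].
    exact: (side_walk (b := true) h (side_tip e true)).
  have /filtrationP[/(_ e true (conj aj ae)) /= + _] := xa.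
  by rewrite /arrow_minus; case: asboolP => // _ ->; left.
Qed.

(** On [src e], vanishing under [e] is the condition of the new boundary arrow of
    the part of [a] behind [e]. *)
Lemma filtration_kernel a e (x : V (src e)) : arrow_in a e ->
  filtration V a _ x -> rep_map V e x = 0 -> filtration_lt V a _ x.
Proof.
move=> [as_ at_] /filtrationP[x1 x2] x0.
have bc : connected_full (csub_set a `&` behind e).
  apply: (@star_connected _ _ (src e)).
    by split => //; exact: (side_tip e false).
  move=> i [ai ei]; have [p pI] := fw_exists (src e) i; exists p => v pv; split.
    exact: (connected_convex (csubP a) pI as_ ai pv).
  apply: (connected_convex (side_connected e false) pI _ ei pv).
  exact: (side_tip e false).
pose b := CSub bc.
apply: (filtration_lt_in (b := b)); first by apply: t_step; left; exists e.
apply/filtrationP; split=> [d c bd|E bE]; last first.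
  by apply: x2 => j /bE[].
have [de|de] := pselect (d = e); last first.
  by apply: x1; apply: reduction_boundary bd de.
subst d; case: c bd => -[h1 h2]; last first.
  case: h1 => _ /(side_disjoint (b := false)).
  by case; exact: (side_tip e true).
rewrite boundary_condE /=; last exact: (side_tip e false).
rewrite transport_bwd; last exact: (side_tip e true).
by rewrite transport_self.
Qed.

(** Behind [e] there is, up to equality of the subspaces they define, a single
    condition, as every boundary arrow of [a] behind [e] hides a virtual arrow
    beyond it.  At the target of [e] this condition is the image of its value at
    the source; the lift that it gives satisfies all conditions from in front of
    [e], which are preimages at the source. *)
Lemma filtration_onto a e x : one_virtual_boundary_behind e -> arrow_in a e ->
  filtration V a (tgt e) x ->
  exists2 y, filtration V a (src e) y & rep_map V e y = x.
Proof.
move=> [E0 [_ [E0' E0'0 E0e] E0u]] [as_ at_] /filtrationP[x1 x2].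
have uniq (E : varrow Q) : walk_vertices E `<=` behind e -> same_varrow E0 E.
  by move=> Ee; apply: E0u => //; exists E => //; exact: end_segment_refl.
have beyond d c : boundary_at a d c -> side e false (tip d c) ->
    exists2 E : varrow Q, walk_vertices E `<=` side d c &
      walk_vertices E `<=` behind e.
  move=> bd ed; have [E Ed] := side_virtual d c eo; exists E => //.
  apply: (subset_trans Ed); apply: (boundary_side (b' := false) _ ed as_ bd).
  by move=> de; case: bd; rewrite de; case: (c).
have same2 (E E' : varrow Q) A B :
    walk_vertices E `<=` behind e -> walk_vertices E' `<=` behind e ->
    walk_vertices E `<=` A -> walk_vertices E' `<=` B -> A `&` B !=set0.
  move=> /uniq EE /uniq EE'.
  move=> /walk_vertices_eventually EA /walk_vertices_eventually EB.
  apply: (eventually_in_disjoint _ EB).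
  apply/(same_varrow_ind (P := fun E => eventually_in E A) _ EE').
    by move=> ? ?; exact: eventually_in_end.
  apply/(same_varrow_ind (P := fun E => eventually_in E A) _ EE) => // ? ?.
  exact: eventually_in_end.
suff [y yx [yd yE]] : exists2 y, rep_map V e y = x &
    (forall d c, boundary_at a d c -> side e false (tip d c) ->
      boundary_cond V d c _ y) /\
    (forall E : varrow Q,
      walk_vertices E `<=` csub_set a -> walk_vertices E `<=` behind e ->
      virtual_plus V E _ y).
  exists y => //; apply/filtrationP; split=> [d c bd|E aE].
    have [ed|ed] := side_total e false (tip d c); first exact: yd.
    have de : d <> e by move=> de; case: bd; rewrite de; case: (c).
    have := x1 _ _ bd.
    rewrite !boundary_condE; try by apply: (boundary_sub bd).
    rewrite -yx (@transport_bwd _ _ _ (tgt d)) //.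
    exact: (side_tips c true de ed).
  have [Es|Es] := pselect (walk_vertices E (src e)).
    by apply/virtual_plusP; exists (src e) => //; rewrite reach_self.
  have Ene : ~ (walk_vertices E (src e) /\ walk_vertices E (tgt e)) by case.
  have [j Ej] := virtual_nonempty E.
  have [ej|ej] := side_total e false j.
    by apply: yE => //; exact: (connected_side (varrow_connected E) Ene Ej ej).
  have Ee := connected_side (varrow_connected E) Ene Ej ej.
  have /virtual_plusP[l El xl] := x2 E aE.
  apply/virtual_plusP; exists l => //.
  rewrite /reach transport_bwd; last exact: Ee.
  by rewrite /preimage /= yx.
have [[d [c [bd de ed]]]|sa] := boundary_or_sub (b := false) as_.
  have := x1 _ _ bd; rewrite boundary_condE; last by apply: (boundary_sub bd).
  rewrite transport_fwd; last exact: (side_tips c true de ed).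
  move=> [y yd yx]; exists y => //.
  have [E Ed Ee] := beyond _ _ bd ed.
  split=> [d' c' bd' ed'|E' aE' eE'].
    have [dd'|dd'] := pselect (d = d').
      subst d'; have -> : c' = c.
        case: bd bd' => h1 h2 [h3 h4].
        by move: h1 h2 h3 h4; case: (c); case: (c').
      by rewrite boundary_condE//; apply: (boundary_sub bd).
    have [E' Ed' Ee'] := beyond _ _ bd' ed'.
    have [j [/side_disjoint dj]] := same2 _ _ _ _ Ee Ee' Ed Ed'.
    by move=> /(boundary_disjoint bd bd' dd').
  have [j [/side_disjoint dj]] := same2 _ _ _ _ Ee eE' Ed aE'.
  by move=> /(boundary_sub bd).
(* All of the tree behind [e] is in [a]: the virtual arrow there is in [a]. *)
have /virtual_plusP[j E0j] := x2 _ (subset_trans E0e sa).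
rewrite /reach transport_fwd; last exact: E0e.
move=> [y yj yx]; exists y => //; split=> [d c bd ed|E aE eE].
  by case: bd => _; case; exact: sa.
apply/(virtual_plus_same _ (uniq E eE)).
apply/(virtual_plus_same _ (uniq _ E0e)).
by apply/virtual_plusP; exists j.
Qed.

(** Each term of the image of [x] lifts to a smaller subquiver: one that contains
    [tgt e], after [filtration_support], also contains [src e].  The difference
    between [x] and the sum of the lifts is in the kernel of [e]. *)
Lemma filtration_inj a e (x : V (src e)) : one_virtual_boundary_behind e ->
  arrow_in a e -> filtration V a _ x -> filtration_lt V a _ (rep_map V e x) ->
  filtration_lt V a _ x.
Proof.
move=> one ae xa [n [b [y [by_ xy]]]].
have Ncl i : submod_closed [in filtration_lt V a i] := subrep_closed _ i.
have lift m : exists z, filtration_lt V a (src e) z /\ rep_map V e z = y m.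
  have [ba yb] := by_ m.
  have [->|[b' [b'b b't yb']]] := filtration_support yb.
    by exists 0; split; [exact: submod0|rewrite linear0].
  have b'a : csub_lt b' a.
    by case: b'b => [->//|]; exact: t_trans.
  have b's := csub_lt_src b'a ae b't.
  have [z zb' zy] := filtration_onto one (conj b's b't) yb'.
  by exists z; split => //; exact: filtration_lt_in b'a _ zb'.
have [z zP] := choice lift.
have sz : filtration_lt V a _ (\sum_m z m).
  apply: (big_ind (fun x => filtration_lt V a (src e) x)).
  - exact: submod0.
  - by move=> u v ua va; rewrite -[u]scale1r; exact: submodZ.
  - by move=> m _; have [] := zP m.
have xz : filtration V a _ (x - \sum_m z m).
  rewrite addrC -scaleN1r; apply: submodZ (filtration_closed V a _) _ _ => //.
  exact: filtration_lt_sub.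
rewrite -[x](subrK (\sum_m z m)) -[_ - _]scale1r; apply: submodZ => //.
apply: filtration_kernel ae xz _; rewrite linearB linear_sum /= xy.
by apply/eqP; rewrite subr_eq0; apply/eqP/eq_bigr => m _; have [] := zP m.
Qed.

End Support.

(** * Complements of subspaces *)

Section Complements.
Variables (k : fieldType) (V : lmodType k).
Implicit Types A B C : set V.

Definition is_complement A B C : Prop :=
  [/\ submod_closed [in C], C `<=` B, forall x, C x -> A x -> x = 0 &
      forall x, B x -> exists2 c, C c & A (x - c)].

Lemma submodN A x : submod_closed [in A] -> A x -> A (- x).
Proof.
move=> Acl Ax; rewrite -[- x]addr0 -scaleN1r; apply: submodZ => //.
exact: submod0.
Qed.

Lemma submodD A x y : submod_closed [in A] -> A x -> A y -> A (x + y).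
Proof. by move=> Acl Ax Ay; rewrite -[x]scale1r; exact: submodZ. Qed.

(** A maximal subset of [B] among those stable under linear combinations and
    meeting [A] in at most 0.  The empty set is allowed, so that the union of the
    empty chain is. *)
Lemma complement_exists A B : submod_closed [in A] -> submod_closed [in B] ->
  exists C, is_complement A B C.
Proof.
move=> Acl Bcl.
pose P C := [/\ forall a x y, C x -> C y -> C (a *: x + y), C `<=` B &
  forall x, C x -> A x -> x = 0].
have [F FP Ftot|C [[CZ CB CA] Cmax]] := @Zorn_bigcup V P.
  split.
  - move=> a x y [X FX Xx] [Y FY Yy].
    have [XZ _ _] := FP _ FX; have [YZ _ _] := FP _ FY.
    have [/(_ _ Xx) Yx|/(_ _ Yy) Xy] := Ftot _ _ FX FY.
      by exists Y => //; exact: YZ.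
    by exists X => //; exact: XZ.
  - by move=> x [X /FP[_ XB _] /XB].
  - by move=> x [X /FP[_ _ XA] /XA].
have C0 : C 0.
  apply: contrapT => nC0; have Ce x : ~ C x.
    by move=> Cx; apply: nC0; rewrite -(subrr x) addrC -scaleN1r; exact: CZ.
  apply: (Cmax [set 0]); first by split=> [x /Ce//|/(_ 0 erefl)].
  split=> [a x y -> ->|x ->|//]; first by rewrite scaler0 addr0.
  exact: submod0.
have Ccl : submod_closed [in C] by exact: submod_closedP.
exists C; split => // x Bx; apply: contrapT => nx.
pose C' := [set y | exists a, C (y - a *: x)].
apply: (Cmax C').
  split=> [y Cy|]; first by exists 0; rewrite scale0r subr0.
  move=> /(_ x) xC; apply: nx; exists x; last by rewrite subrr; exact: submod0.
  by apply: xC; exists 1; rewrite scale1r subrr.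
split.
- move=> a y z [b yb] [c zc]; exists (a * b + c).
  rewrite scalerDl -scalerA opprD addrACA -scalerBr; exact: CZ.
- move=> y [a /CB ya]; rewrite -(subrK (a *: x) y) addrC.
  exact: submodZ.
- move=> y [a Cy Ay]; have [a0|a0] := eqVneq a 0.
    by rewrite a0 scale0r subr0 in Cy; exact: CA.
  case: nx; exists (- (a^-1 *: (y - a *: x))).
    apply: submodN => //; rewrite -[_ *: _]addr0; exact: submodZ.
  rewrite opprK scalerBr scalerA mulVf// scale1r addrC subrK.
  by rewrite -[_ *: _]addr0; apply: submodZ => //; exact: submod0.
Qed.

Lemma get_complement_exists A B : exists C,
  submod_closed [in A] -> submod_closed [in B] -> is_complement A B C.
Proof.
have [[Acl Bcl]|h] := pselect (submod_closed [in A] /\ submod_closed [in B]).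
  by have [C CP] := complement_exists Acl Bcl; exists C.
by exists set0 => Acl Bcl; case: h.
Qed.

(** Defined for all subsets, so that it can be used in a recursion before the
    subsets are known to be subspaces. *)
Definition get_complement A B : set V :=
  projT1 (cid (get_complement_exists A B)).

Lemma get_complementP A B : submod_closed [in A] -> submod_closed [in B] ->
  is_complement A B (get_complement A B).
Proof. by rewrite /get_complement; case: cid. Qed.

End Complements.

(** * Complements of subrepresentations and sections *)

Section Splitting.
Variables (k : fieldType) (Q : quiver) (V : rep k Q) (U C N : subrep V).
Hypothesis UCN : internal_dsum U C N.

Let W := quot_rep (sub_in U N).
Let p : rep_hom (subrep_rep U) W := quot_hom (sub_in U N).

Lemma splitting_exists i (x : W i) :
  exists y : subrep_rep U i, C i (\val y) /\ p i y = x.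
Proof.
have [UE _] := UCN i.
have : U i (\val (repr x)) by exact: set_mem (valP (repr x)).
rewrite {1}UE => -[c Cc [n Nn cn]].
have Uc : U i c.
  rewrite UE; exists c => //; exists 0; last by rewrite addr0.
  by apply: submod0; exact: subrep_closed.
exists (SigSub (mem_set Uc)); split => //.
rewrite -[x]projK; apply/proj_eq; rewrite /sub_in /=.
change (N i (c - \val (repr x))).
rewrite -cn opprD addrA subrr add0r; apply: submodN Nn; exact: subrep_closed.
Qed.

Lemma splitting_unique i (y z : subrep_rep U i) :
  C i (\val y) -> C i (\val z) -> p i y = p i z -> y = z.
Proof.
have [_ CN] := UCN i.
move=> Cy Cz /proj_eq Nyz.
apply: val_inj; apply/eqP; rewrite -subr_eq0; apply/eqP.
suff : (C i `&` N i) (\val y - \val z) by rewrite CN.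
split; last exact: Nyz.
apply: submodD Cy _; first exact: subrep_closed.
by apply: submodN => //; exact: subrep_closed.
Qed.

Definition splitting i (x : W i) : subrep_rep U i :=
  projT1 (cid (splitting_exists x)).

Lemma splittingP i (x : W i) :
  C i (\val (splitting x)) /\ p i (splitting x) = x.
Proof. by rewrite /splitting; case: cid. Qed.

Lemma splitting_linear i : linear (@splitting i).
Proof.
move=> a x y; have [Cx px] := splittingP x; have [Cy py] := splittingP y.
have [Cxy pxy] := splittingP (a *: x + y).
apply: splitting_unique => //.
  change (C i (a *: \val (splitting x) + \val (splitting y))).
  by apply: submodZ => //; exact: subrep_closed.
by rewrite linearP px py.
Qed.

HB.instance Definition _ i :=
  GRing.isLinear.Build k _ _ _ (@splitting i) (@splitting_linear i).

Lemma splitting_natural e (x : W (src e)) :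
  splitting (rep_map W e x) = rep_map (subrep_rep U) e (splitting x).
Proof.
have [Cx px] := splittingP x; have [Cy py] := splittingP (rep_map W e x).
apply: splitting_unique => //.
  change (C (tgt e) (rep_map V e (\val (splitting x)))).
  exact: subrep_stable.
by rewrite py hom_natural px.
Qed.

(** The section picks the unique representative in [C] of each class. *)
Lemma internal_dsum_right_inverse : has_right_inverse p.
Proof.
exists (@RepHom k Q W (subrep_rep U)
  (fun i => @splitting i : {linear W i -> subrep_rep U i}) splitting_natural).
by move=> i x; have [] := splittingP x.
Qed.

End Splitting.

(** * The complement carried around the tree *)

Section Gradation.
Variables (k : fieldType) (Q : tree) (V : rep k Q).
Hypothesis eo : eventually_outward Q.
Variable a : csub Q.
Hypothesis one : forall e, arrow_in a e -> one_virtual_boundary_behind e.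
Implicit Types (i j h : Q) (e : arrow Q).

Let F := filtration V a.
Let N := filtration_lt V a.

Lemma submodI (W : lmodType k) (A B : set W) :
  submod_closed [in A] -> submod_closed [in B] -> submod_closed [in A `&` B].
Proof.
move=> Acl Bcl; apply: submod_closedP; first by split; exact: submod0.
by move=> c x y [Ax Bx] [Ay By]; split; exact: submodZ.
Qed.

Definition lift_space e (C : set (V (tgt e))) : set (V (src e)) :=
  rep_map V e @^-1` C `&` F (src e).

Lemma lift_space_complement e (C : set (V (tgt e))) : submod_closed [in C] ->
  is_complement (lift_space C `&` N (src e)) (lift_space C)
    (get_complement (lift_space C `&` N (src e)) (lift_space C)).
Proof.
move=> Ccl; have Lcl : submod_closed [in lift_space C].
  by apply: submodI; [exact: submod_preimage|exact: subrep_closed].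
by apply: (get_complementP _ Lcl); apply: (submodI Lcl); exact: subrep_closed.
Qed.

(** Surjectivity of [F] makes the image span modulo [N]; injectivity modulo [N]
    keeps it away from [N]. *)
Lemma image_complement e C : arrow_in a e ->
  is_complement (N (src e)) (F (src e)) C ->
  is_complement (N (tgt e)) (F (tgt e)) (rep_map V e @` C).
Proof.
move=> ae [Ccl CF CN CD]; split.
- exact: submod_image.
- by move=> _ [x /CF Fx <-]; exact: filtration_stable.
- move=> _ [x Cx <-] Nx; rewrite (CN x Cx) ?linear0//.
  exact: (filtration_inj eo (one ae) ae (CF _ Cx) Nx).
- move=> x Fx; have [y Fy <-] := filtration_onto eo (one ae) ae Fx.
  have [c Cc Nyc] := CD y Fy; exists (rep_map V e c); first by exists c.
  by rewrite -linearB; exact: subrep_stable.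
Qed.

(** Modulo [N], injectivity lets one correct any element of [F] so that its image
    falls in [C]: subtract from it a lift of the [C]-component of its image. *)
Lemma lift_complement e C C' : arrow_in a e ->
  is_complement (N (tgt e)) (F (tgt e)) C ->
  is_complement (lift_space C `&` N (src e)) (lift_space C) C' ->
  is_complement (N (src e)) (F (src e)) C'.
Proof.
move=> ae [Ccl CF CN CD] [C'cl C'F C'N C'D]; split => //.
- by move=> x /C'F[].
- by move=> x C'x Nx; apply: C'N => //; split => //; exact: C'F.
- move=> x Fx; have [c Cc Nxc] := CD _ (filtration_stable Fx).
  have [y Fy yc] := filtration_onto eo (one ae) ae (CF _ Cc).
  have [c' C'c' [_ Nyc']] : exists2 c', C' c' &
      (lift_space C `&` N (src e)) (y - c').
    by apply: C'D; split => //; rewrite /preimage /= yc.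
  exists c' => //; rewrite -(subrK y x) -addrA; apply: submodD Nyc' => //.
    exact: subrep_closed.
  apply: (filtration_inj eo (one ae) ae); last by rewrite linearB yc.
  apply: submodD => //; first exact: subrep_closed.
  by apply: submodN => //; exact: subrep_closed.
Qed.

(** Only crossing an arrow backwards needs a new choice, inside the preimage of
    what was chosen before, so that the arrow maps the one to the other. *)
Fixpoint walk_complement h j (p : fwalk h j) : set (V j) :=
  match p with
  | fw_nil => get_complement (N h) (F h)
  | fw_fwd e q => rep_map V e @` walk_complement q
  | fw_bwd e q => get_complement
      (lift_space (walk_complement q) `&` N (src e))
      (lift_space (walk_complement q))
  end.

Lemma walk_complementP h j (p : fwalk h j) : fw_vertices p `<=` csub_set a ->
  is_complement (N j) (F j) (walk_complement p).
Proof.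
elim: p => [_|e p IH pa|e p IH pa] /=.
- apply: get_complementP; first exact: (subrep_closed N).
  exact: (subrep_closed F).
- apply: image_complement; last by apply: IH => v pv; apply: pa; left.
  by split; apply: pa; [left; exact: fw_end|right].
- have Cp : is_complement (N (tgt e)) (F (tgt e)) (walk_complement p).
    by apply: IH => v pv; apply: pa; left.
  apply: (lift_complement _ Cp).
    by split; apply: pa; [right|left; exact: fw_end].
  by apply: lift_space_complement; case: Cp.
Qed.

(** No walk in [a] ends outside [a]; the disjunct [x = 0] is for the vertices
    there. *)
Definition tree_complement h j : set (V j) :=
  [set x | x = 0 \/ exists p : fwalk h j,
    [/\ fw_injective p, fw_vertices p `<=` csub_set a & walk_complement p x]].
Arguments tree_complement h j _ : clear implicits.

Lemma tree_complementE h j (p : fwalk h j) : fw_injective p ->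
  fw_vertices p `<=` csub_set a -> tree_complement h j = walk_complement p.
Proof.
move=> pI pa; have [Ccl _ _ _] := walk_complementP pa.
apply/seteqP; split=> [x [->|[q [qI _ qx]]]|x px].
- exact: submod0.
- by rewrite (fw_uniq pI qI).
- by right; exists p.
Qed.

Lemma tree_complementP h j : csub_set a h ->
  is_complement (N j) (F j) (tree_complement h j).
Proof.
move=> ah; have [p pI] := fw_exists h j.
have [aj|aj] := pselect (csub_set a j).
  have pa := connected_convex (csubP a) pI ah aj.
  by rewrite (tree_complementE pI pa); exact: walk_complementP.
have -> : tree_complement h j = [set 0].
  apply/seteqP; split=> [x [//|[q [_ qa _]]]|x ->]; last by left.
  by case: aj; apply: qa; exact: fw_end.
split.
- exact: submod_set0.
- by move=> _ ->; apply: submod0; exact: subrep_closed.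
- by [].
- move=> x Fx; exists 0 => //; rewrite subr0.
  have [->|[b [[ba|ba] bj xb]]] := filtration_support eo Fx.
  + by apply: submod0; exact: subrep_closed.
  + by case: aj; rewrite -ba.
  + exact: filtration_lt_in xb.
Qed.

(** Inside [a], the injective walks from [h] to the ends of [e] differ by [e], so
    one complement was built from the other across [e].  An arrow leaving [a]
    kills [F] by its own boundary condition. *)
Lemma tree_complement_stable h e x : csub_set a h ->
  tree_complement h (src e) x -> tree_complement h (tgt e) (rep_map V e x).
Proof.
move=> ah hx; have [at_|at_] := pselect (csub_set a (tgt e)); last first.
  left; case: hx => [->|[p [pI pa px]]]; first exact: linear0.
  have as_ : csub_set a (src e) by apply: pa; exact: fw_end.
  have [_ CF _ _] := walk_complementP pa.
  have bd : boundary_at a e true by [].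
  have /filtrationP[/(_ _ _ bd) + _] := CF x px.
  rewrite boundary_condE; last exact: (side_tip e false).
  rewrite transport_bwd; last exact: (side_tip e true).
  by rewrite transport_self.
case: hx => [->|[p [pI pa px]]]; first by left; exact: linear0.
right; have [fI|[q [qI qe] pq]] := fw_step pI.
  exists (fw_fwd p); split => //; last by exists x.
  by move=> v [/pa//|->].
have qa : fw_vertices q `<=` csub_set a.
  by move=> v qv; apply: pa; rewrite pq; left.
exists q; split => //; rewrite pq in px.
have [qcl _ _ _] := walk_complementP qa.
by have [_ CL _ _] := lift_space_complement qcl; have [] := CL x px.
Qed.

Lemma complement_subrep : exists C : subrep V,
  subrep_le C F /\ internal_dsum F C N.
Proof.
have [[h ah] _] := csubP a.
have Ccl i : submod_closed [in tree_complement h i].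
  by have [] := tree_complementP i ah.
exists (SubRep Ccl (fun e x => tree_complement_stable ah)); split=> i.
  by have [] := tree_complementP i ah.
have [/= _ CF CN CD] := tree_complementP i ah.
split; apply/seteqP; split=> x.
- move=> /CD[c Cc Nc]; exists c => //; exists (x - c) => //.
  by rewrite addrC subrK.
- move=> [c Cc [n Nn <-]]; apply: submodD; first exact: (subrep_closed F).
    exact: CF.
  exact: filtration_lt_sub.
- by move=> [Cx Nx]; exact: CN.
- by move=> ->; split; apply: submod0; [exact: Ccl|exact: (subrep_closed N)].
Qed.

End Gradation.

Theorem proposition5p2 (k : fieldType) (Q : tree) (V : rep k Q)
    (hfb : finitely_branched Q) (heo : eventually_outward Q) :
  (forall a : csub Q,
     (forall e : arrow Q, arrow_in a e -> one_virtual_boundary_behind e) ->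
     has_right_inverse (graded_quotient_map V a) /\
     (exists C : subrep V,
        subrep_le C (filtration V a) /\
        internal_dsum (filtration V a) C (filtration_lt V a))) /\
  ((forall (a : csub Q) (e : arrow Q),
      arrow_in a e -> one_virtual_boundary_behind e) ->
   exists C : csub Q -> subrep V, almost_gradation C).
Proof.
split=> [a one|one].
  have [C [CF dsum]] := complement_subrep V heo one.
  by split; [exact: internal_dsum_right_inverse dsum|exists C].
have [C CP] := choice (fun a => complement_subrep V heo (one a)).
by exists C => a; case: (CP a).
Qed.
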